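(* Let $p=\sum_{\mu_1+\dots+\mu_n=d}p_{\boldsymbol\mu}\mathbf{x}^{\boldsymbol\mu}\in\mathbb{R}_+[x_1,\dots,x_n]$ be a denormalized Lorentzian polynomial of degree $d$, and let $\boldsymbol\alpha\in\mathbb{N}^n$ with $\alpha_1+\dots+\alpha_n=d$. For $1\le i\le n-1$ let $d_i$ be the degree in $x_i$ of the polynomial $\partial_{i+1}^{\alpha_{i+1}}\cdots\partial_n^{\alpha_n}p\,\big|_{x_{i+1}=\dots=x_n=0}$, and let $d_n$ be the degree of $x_n$ in $p$. Then \[ p_{\boldsymbol\alpha}\ \ge\ \Biggl[\prod_{i=2}^n\mathrm{cap}_{(d_i-\alpha_i,\alpha_i)}\Bigl(\sum_{k=0}^{d_i}x^ky^{d_i-k}\Bigr)\Biggr]^{-1}\mathrm{cap}_{\boldsymbol\alpha}(p)\ \ge\ \prod_{i=2}^n\max\left\{\frac{\alpha_i^{\alpha_i}}{(\alpha_i+1)^{\alpha_i+1}},\ \frac{(d_i-\alpha_i)^{d_i-\alpha_i}}{(d_i-\alpha_i+1)^{d_i-\alpha_i+1}}\right\}\mathrm{cap}_{\boldsymbol\alpha}(p). \]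
   Context: For $q\in\mathbb{R}_+[x_1,\dots,x_n]$ and $\boldsymbol\alpha\in\mathbb{R}_+^n$, $\mathrm{cap}_{\boldsymbol\alpha}(q)=\inf_{\mathbf{x}\in\mathbb{R}_{>0}^n}q(\mathbf{x})/\prod_ix_i^{\alpha_i}$ (and for bivariate $q(x,y)$, $\mathrm{cap}_{(a,b)}(q)=\inf_{x,y>0}q(x,y)/(x^ay^b)$). A real symmetric matrix has Lorentzian signature if it is nonsingular with exactly one positive eigenvalue. A homogeneous $q\in\mathbb{R}_+[x_1,\dots,x_n]$ of degree $d\ge2$ is strictly Lorentzian if all its degree-$d$ coefficients are positive and, for every sequence $1\le i_1,\dots,i_{d-2}\le n$ and every $\mathbf{x}\in\mathbb{R}_{>0}^n$, the Hessian of $\partial_{i_1}\cdots\partial_{i_{d-2}}q$ at $\mathbf{x}$ has Lorentzian signature; $q$ is Lorentzian if it is a limit of strictly Lorentzian polynomials of degree $d$ (degree $0$ or $1$ homogeneous polynomials with nonnegative coefficients are Lorentzian). The normalization of $q=\sum q_{\boldsymbol\mu}\mathbf{x}^{\boldsymbol\mu}$ is $N[q]=\sum q_{\boldsymbol\mu}\mathbf{x}^{\boldsymbol\mu}/\prod_i\mu_i!$; a homogeneous $q\in\mathbb{R}_+[x_1,\dots,x_n]$ is denormalized Lorentzian if $N[q]$ is Lorentzian. Convention $0^0=1$. *)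

(* Defs.v *)
From HB Require Import structures.
From mathcomp Require Import all_boot all_order all_algebra.
(* mpoly must be imported before the analysis files: in the other order the
   notation levels clash. *)
From mathcomp Require Import mpoly.
From mathcomp Require Import all_classical all_reals all_analysis.
Set Implicit Arguments.
Unset Strict Implicit.
Unset Printing Implicit Defensive.
Import Order.TTheory GRing.Theory Num.Theory.
Import numFieldNormedType.Exports.
Local Open Scope classical_set_scope.
Local Open Scope ring_scope.

Section Definitions.
Variable R : realType.

Definition nonneg_coeffs (n : nat) (q : {mpoly R[n]}) : Prop :=
  forall m : 'X_{1..n}, 0 <= q@_m.

Definition capacity (n : nat) (alpha : 'I_n -> R) (q : {mpoly R[n]}) : R :=
  inf [set q.@[x] / \prod_(i < n) (x i) `^ (alpha i)
      | x in [set x : 'I_n -> R | forall i, 0 < x i]].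

(* Eigenvalues are counted with multiplicity, as roots of the characteristic
   polynomial. *)
Definition lorentzian_signature (n : nat) (A : 'M[R]_n) : Prop :=
  [/\ A^T = A, A \in unitmx &
      exists a : R, [/\ 0 < a, mup a (char_poly A) = 1%N &
        forall b : R, 0 < b -> eigenvalue A b -> b = a]].

Definition hessian (n : nat) (q : {mpoly R[n]}) (x : 'I_n -> R) : 'M[R]_n :=
  \matrix_(i < n, j < n) ((q^`M(j))^`M(i)).@[x].

Definition iter_partial (n : nat) (s : seq 'I_n) (q : {mpoly R[n]}) :
    {mpoly R[n]} :=
  foldr (fun i r => r^`M(i)) q s.

Definition strictly_lorentzian (n d : nat) (q : {mpoly R[n]}) : Prop :=
  [/\ (2 <= d)%N, q \is d.-homog,
      forall m : 'X_{1..n}, mdeg m = d -> 0 < q@_m &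
      forall (s : (d - 2).-tuple 'I_n) (x : 'I_n -> R), (forall i, 0 < x i) ->
        lorentzian_signature (hessian (iter_partial s q) x)].

(* The limit is taken in the finite-dimensional space of degree-d forms, that
   is, coefficientwise. *)
Definition lorentzian (n d : nat) (q : {mpoly R[n]}) : Prop :=
  if (d < 2)%N then q \is d.-homog /\ nonneg_coeffs q
  else exists u : nat -> {mpoly R[n]},
    (forall k, strictly_lorentzian d (u k)) /\
    (forall m : 'X_{1..n}, (fun k => (u k)@_m) @ \oo --> q@_m).

Definition normalization (n : nat) (q : {mpoly R[n]}) : {mpoly R[n]} :=
  \sum_(m <- msupp q) (q@_m / (\prod_(i < n) (m i)`!)%:R) *: 'X_[m].

Definition denormalized_lorentzian (n d : nat) (q : {mpoly R[n]}) : Prop :=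
  [/\ q \is d.-homog, nonneg_coeffs q & lorentzian d (normalization q)].

(* By convention the zero polynomial has degree 0 in each variable. *)
Definition deg_in (n : nat) (i : 'I_n) (q : {mpoly R[n]}) : nat :=
  \max_(m <- msupp q) m i.

(* Differentiate alpha_j times in each x_j with j > i, then set these x_j to 0;
   for the last variable this is q itself. *)
Definition partial_restr (n : nat) (alpha : 'X_{1..n}) (i : 'I_n)
    (q : {mpoly R[n]}) : {mpoly R[n]} :=
  q^`M[[multinom (if (i < j)%N then alpha j else 0%N) | j < n]]
    \mPo [tuple (if (i < j)%N then 0 else 'X_j) | j < n].

Definition deg_step (n : nat) (alpha : 'X_{1..n}) (q : {mpoly R[n]})
    (i : 'I_n) : nat :=
  deg_in i (partial_restr alpha i q).

(* sum_(k = 0 .. e) x^k y^(e - k), with x = 'X_0 and y = 'X_1 *)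
Definition geometric_form (e : nat) : {mpoly R[2]} :=
  \sum_(k < e.+1) 'X_(0 : 'I_2) ^+ k * 'X_(1 : 'I_2) ^+ (e - k).

Definition bicapacity (a b : R) (q : {mpoly R[2]}) : R :=
  capacity (tnth [tuple a; b]) q.

(* z^z / (z + 1)^(z + 1), with an integer argument so that a difference
   e - a with e < a is not truncated; 0 ^ 0 = 1 for integer powers. *)
Definition pow_ratio (z : int) : R :=
  (z%:~R) ^ z / ((z + 1)%:~R) ^ (z + 1).

End Definitions.

Arguments geometric_form R e : clear implicits.
Arguments pow_ratio R z : clear implicits.

(* Main.v *)
Require Import Defs.
From HB Require Import structures.
From mathcomp Require Import all_boot all_order all_algebra.
From mathcomp Require Import mpoly.
From mathcomp Require Import all_classical all_reals all_analysis.
From mathcomp Require Import complex spectral sesquilinear ring lra zify.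
Set Implicit Arguments.
Unset Strict Implicit.
Unset Printing Implicit Defensive.
Import Order.TTheory GRing.Theory Num.Theory.
Import numFieldNormedType.Exports.
Local Open Scope ring_scope.

(** Writing [p] as a linear functional on monomials (the denormalized
    coefficients), a Lorentzian polynomial becomes a functional [phi] whose
    quadratic forms [(v, w) |-> phi (v * w * N)], [N] a product of letters, are
    hyperbolic. The key point is that specializing several variables of a
    denormalized Lorentzian polynomial to multiples of one variable preserves
    this property. Two letters [x1], [x2] are merged into a new letter ['X] by
    passing to the functional [q |-> phi (q[x1, x2])] on [{poly A}], where
    [q[x1, x2]] is the divided difference; this models the intersection form of
    a projective bundle, with boundary divisors ['X - x1] and ['X - x2].
    Hyperbolicity is propagated from the letters to the new functional by the
    Bochner method (Shenfeld--van Handel, Cordero-Erausquin et al.).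
    Hence the coefficients of [p] in one variable, the previous ones being
    specialized to positive reals and the next ones being extracted, form a
    log-concave sequence [c] without internal zeros, so [c k <= c m * r ^ (k - m)]
    for some [r > 0]. Taking the infimum over the eliminated variable bounds the
    capacity by [c m] times the capacity of the geometric form, and the theorem
    follows by eliminating the variables one after the other, the last first. *)

(** * Bochner inequality *)

Section Dot.
Variables (R : realFieldType) (k : nat).
Implicit Types (u v w x y : 'I_k -> R) (M : 'I_k -> 'I_k -> R).

Definition dot u v : R := \sum_i u i * v i.
Definition mxapp M v : 'I_k -> R := fun i => \sum_j M i j * v j.

Lemma dotC u v : dot u v = dot v u.
Proof. by apply: eq_bigr => i _; rewrite mulrC. Qed.

Lemma dot_sym_app M u v : (forall i j, M i j = M j i) ->
  dot u (mxapp M v) = dot v (mxapp M u).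
Proof.
move=> symM; rewrite /dot /mxapp.
under eq_bigr do rewrite mulr_sumr.
rewrite exchange_big /=; apply: eq_bigr => j _; rewrite mulr_sumr.
by apply: eq_bigr => i _; rewrite (symM i j); ring.
Qed.

Lemma dot_linr u a v b w :
  dot u (fun i => a * v i + b * w i) = a * dot u v + b * dot u w.
Proof. by rewrite /dot !mulr_sumr -big_split; apply: eq_bigr => i _ /=; ring. Qed.

Lemma app_lin M a v b w i :
  mxapp M (fun i => a * v i + b * w i) i = a * mxapp M v i + b * mxapp M w i.
Proof. by rewrite /mxapp !mulr_sumr -big_split; apply: eq_bigr => j _ /=; ring. Qed.

Lemma dot_linl u a v b w :
  dot (fun i => a * v i + b * w i) u = a * dot v u + b * dot w u.
Proof. by rewrite dotC dot_linr !(dotC u). Qed.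

Lemma dot_app_linr M u a v b w :
  dot u (mxapp M (fun i => a * v i + b * w i)) =
  a * dot u (mxapp M v) + b * dot u (mxapp M w).
Proof. by rewrite -dot_linr; apply: eq_bigr => i _; rewrite app_lin. Qed.

(** The form is nonnegative at [c * u - b * v], where its value is [c * (a * c - b ^+ 2)]. *)
Lemma psd_cauchy_schwarz M u v : (forall i j, M i j = M j i) ->
  (forall w, 0 <= dot w (mxapp M w)) ->
  dot u (mxapp M v) ^+ 2 <= dot u (mxapp M u) * dot v (mxapp M v).
Proof.
move=> symM psd.
set a := dot u (mxapp M u); set b := dot u (mxapp M v); set c := dot v (mxapp M v).
have q s t : 0 <= s ^+ 2 * a + s * t * b *+ 2 + t ^+ 2 * c.
  have := psd (fun i => s * u i + t * v i).
  rewrite dot_linl !dot_app_linr (dot_sym_app v u symM) -/a -/b -/c.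
  by move/le_trans; apply; rewrite le_eqVlt; apply/orP; left; apply/eqP; ring.
have a0 : 0 <= a by exact: psd.
have c0 : 0 <= c by exact: psd.
case: (eqVneq c 0) => [c00|cn0].
  case: (eqVneq b 0) => [->|bn0]; first by rewrite expr0n /= mulr_ge0.
  (* When [c = 0], this choice of [t] brings the form down to [- a - 2], which is impossible. *)
  move: (q 1 (- ((a + 1) / b))); rewrite c00 mulr0 addr0 expr1n !mul1r.
  by rewrite mulNr divfK // => ?; lra.
have := q c (- b).
have -> : c ^+ 2 * a + c * - b * b *+ 2 + (- b) ^+ 2 * c = c * (a * c - b ^+ 2) by ring.
by rewrite pmulr_rge0 ?lt_def ?cn0 // subr_ge0.
Qed.

End Dot.

Section Bochner.
Variables (R : realFieldType) (k : nat) (H : 'I_k -> 'I_k -> R) (x : 'I_k -> R).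
Hypothesis symH : forall i j, H i j = H j i.
Hypothesis offdiag_ge0 : forall i j, i != j -> 0 <= H i j.
Variable hub : 'I_k.
Hypothesis hub_gt0 : forall j, j != hub -> 0 < H hub j.
Hypothesis x_gt0 : forall i, 0 < x i.
Let w := mxapp H x.
Hypothesis w_gt0 : forall i, 0 < w i.
Hypothesis bochner : forall v,
  dot v (mxapp H v) <= \sum_i (mxapp H v i) ^+ 2 * x i / w i.

(** In the unknown [y i / x i], the form of [G] is the Dirichlet energy of the graph with edge
    weights [H i j * x i * x j]; the choice of [e] makes [G] kill [x]. *)
Let e i : R := w i / x i.
Let G i j : R := (i == j)%:R * e i - H i j.

Let x_neq0 i : x i != 0. Proof. by rewrite gt_eqF. Qed.
Let w_neq0 i : w i != 0. Proof. by rewrite gt_eqF. Qed.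
Let e_gt0 i : 0 < e i. Proof. by rewrite divr_gt0. Qed.

Let symG i j : G i j = G j i.
Proof. by rewrite /G symH eq_sym; case: eqP => [->|_]; rewrite ?mul0r. Qed.

Let appG y i : mxapp G y i = e i * y i - mxapp H y i.
Proof.
rewrite /mxapp /G; under eq_bigr do rewrite mulrBl.
rewrite sumrB (bigD1 i) //= eqxx mul1r big1 ?addr0 // => j /negPf ne.
by rewrite eq_sym ne !mul0r.
Qed.

Let quadG y : dot y (mxapp G y) =
  2^-1 * \sum_i \sum_j H i j * x i * x j * (y i / x i - y j / x j) ^+ 2.
Proof.
pose z i := y i / x i.
have yz i : y i = z i * x i by rewrite /z divfK.
have -> : dot y (mxapp G y) = \sum_i \sum_j (H i j * x i * x j * (z i ^+ 2 - z i * z j)).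
  apply: eq_bigr => i _; rewrite appG /e /w {1 2}/mxapp mulrBr !mulr_suml !mulr_sumr -sumrB.
  apply: eq_bigr => j _; rewrite !yz; field; exact: x_neq0.
have sw : \sum_i \sum_j (H i j * x i * x j * (z i ^+ 2 - z i * z j)) =
          \sum_i \sum_j (H i j * x i * x j * (z j ^+ 2 - z i * z j)).
  rewrite exchange_big; apply: eq_bigr => i _; apply: eq_bigr => j _.
  by rewrite symH; ring.
apply: (mulfI (_ : 2 != 0 :> R)); first by lra.
rewrite mulrA mulfV ?mul1r; last by lra.
rewrite -[2]/(1 + 1) mulrDl mul1r {2}sw -big_split; apply: eq_bigr => i _ /=.
by rewrite -big_split; apply: eq_bigr => j _ /=; rewrite -!/(z _); ring.
Qed.

Let term_ge0 y i j : 0 <= H i j * x i * x j * (y i / x i - y j / x j) ^+ 2.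
Proof.
case: (eqVneq i j) => [->|ne]; first by rewrite subrr expr0n mulr0.
by rewrite mulr_ge0 ?sqr_ge0 // !mulr_ge0 ?(ltW (x_gt0 _)) ?offdiag_ge0.
Qed.

Let psdG y : 0 <= dot y (mxapp G y).
Proof.
rewrite quadG mulr_ge0 ?invr_ge0 ?ler0n //.
by apply: sumr_ge0 => i _; apply: sumr_ge0.
Qed.

(** Zero energy makes [y / x] constant along the edges, and the hub is joined to every other vertex,
    so the row of the hub decides. *)
Let kerG y : dot y (mxapp G y) = 0 -> forall j, y j = y hub / x hub * x j.
Proof.
rewrite quadG => /eqP; rewrite mulf_eq0 invr_eq0 pnatr_eq0 /= => /eqP q0 j.
have rowge0 i : 0 <= \sum_j H i j * x i * x j * (y i / x i - y j / x j) ^+ 2.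
  by apply: sumr_ge0.
have /(_ hub isT)/eqP := psumr_eq0P (fun i _ => rowge0 i) q0.
rewrite psumr_eq0 // => /allP/(_ j); rewrite mem_index_enum => /(_ isT)/=.
case: (eqVneq j hub) => [-> _|ne]; first by rewrite divfK.
rewrite !mulf_eq0 !(negPf (x_neq0 _)) gt_eqF ?hub_gt0 //= subr_eq0 orbb.
by move=> /eqP ->; rewrite divfK.
Qed.

(** The image of the symmetric [G] is the orthogonal of its kernel, which is spanned by [x]. *)
Let solveG u : dot u x = 0 -> exists y, forall i, mxapp G y i = u i.
Proof.
move=> ux; pose Gm := \matrix_(i, j) G i j; pose um := \row_i u i.
have Gs : Gm^T = Gm by apply/matrixP => i j; rewrite !mxE.
have /submxP[y uy] : (um <= Gm)%MS.
  rewrite submxE; apply/eqP/matrixP => a j; rewrite [RHS]mxE mxE.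
  pose z i := cokermx Gm i j.
  have zk i : mxapp G z i = 0.
    have /matrixP/(_ i j) := mulmx_coker Gm; rewrite !mxE => <-.
    by apply: eq_bigr => l _; rewrite mxE.
  have /kerG zE : dot z (mxapp G z) = 0 by rewrite /dot big1 // => i _; rewrite zk mulr0.
  transitivity (z hub / x hub * dot u x); last by rewrite ux mulr0.
  rewrite /dot mulr_sumr; apply: eq_bigr => i _; rewrite mxE -/(z i) zE; ring.
exists (y ord0) => i; have := congr1 (fun M : 'rV_k => M ord0 i) uy.
rewrite !mxE => ->; rewrite /mxapp; apply: eq_bigr => j _.
by rewrite mxE mulrC symG.
Qed.

(** Solve [G y = e v], so that [H y = e (y - v)]. The Bochner hypothesis at [y] becomes
    [<y, G y> <= S], where [S = <v, e v> = <y, G v>]. Cauchy-Schwarz for [G] then gives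
    [S <= <v, G v>], that is [<v, H v> <= 0]. *)
Let neg_orth v : dot v w = 0 -> dot v (mxapp H v) <= 0.
Proof.
move=> vw; have [|y yE] := solveG (u := fun i => e i * v i).
  rewrite -vw; apply: eq_bigr => i _; rewrite /e; field; exact: x_neq0.
pose S := dot y (mxapp G v).
have SE : S = \sum_i e i * v i ^+ 2.
  rewrite /S dot_sym_app //; apply: eq_bigr => i _; rewrite yE; ring.
have S0 : 0 <= S.
  by rewrite SE sumr_ge0 // => i _; rewrite mulr_ge0 ?sqr_ge0 // ltW.
have vHv : dot v (mxapp H v) = S - dot v (mxapp G v).
  rewrite SE -sumrB; apply: eq_bigr => i _; rewrite appG; ring.
rewrite vHv subr_le0.
have yGy : dot y (mxapp G y) <= S.
  have := bochner y.
  have -> : \sum_i mxapp H y i ^+ 2 * x i / w i = S - dot y (mxapp G y) *+ 2 + \sum_i e i * y i ^+ 2.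
    rewrite SE -sumrMnl -sumrB -big_split; apply: eq_bigr => i _ /=.
    have hy : mxapp H y i = e i * (y i - v i) by have := yE i; rewrite appG => h; rewrite mulrBr -h; ring.
    rewrite hy (appG y i) hy /e; field; rewrite w_neq0 x_neq0 //.
  have -> : dot y (mxapp H y) = \sum_i e i * y i ^+ 2 - dot y (mxapp G y).
    by rewrite -sumrB; apply: eq_bigr => i _; rewrite appG; ring.
  by move=> h; rewrite mulr2n in h; lra.
have cs := psd_cauchy_schwarz y v symG psdG.
move: S0; rewrite le_eqVlt => /orP[/eqP <-|Sgt0]; first exact: psdG.
rewrite -(ler_pM2l Sgt0) -expr2; apply: le_trans cs _.
by apply: ler_wpM2r; rewrite ?psdG.
Qed.

Lemma bochner_hyperbolic v :
  dot v (mxapp H v) * dot x (mxapp H x) <= dot v (mxapp H x) ^+ 2.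
Proof.
have xw : 0 < dot x w.
  rewrite /dot (bigD1 hub) //= ltr_pwDl ?mulr_gt0 //.
  by apply: sumr_ge0 => i _; rewrite mulr_ge0 ?ltW.
(* Subtracting [s * x] makes [v] orthogonal to [w = H x], where the form is at most 0. *)
pose s := dot v w / dot x w.
have := neg_orth (v := fun i => 1 * v i + (- s) * x i).
rewrite dot_linl mulNr divfK ?gt_eqF // mul1r subrr => /(_ erefl).
rewrite dot_linl !dot_app_linr (dot_sym_app x v symH) -/w !mul1r => h.
have sE : dot v w = s * dot x w by rewrite divfK ?gt_eqF.
rewrite sE in h *.
have : dot v (mxapp H v) <= s ^+ 2 * dot x w by rewrite expr2; nra.
by move/(ler_wpM2r (ltW xw)) => /le_trans; apply; rewrite le_eqVlt; apply/orP; left; apply/eqP; ring.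
Qed.

End Bochner.

(** * Lorentzian functionals *)

Lemma prod_seq_cons (A : comNzRingType) (a : A) s :
  a * \prod_(b <- s) b = \prod_(b <- a :: s) b.
Proof. by rewrite big_cons. Qed.

Section Functional.
Variables (R : realFieldType) (A : comNzRingType) (iota : {rmorphism R -> A}).
Implicit Types (phi : A -> R) (L s : seq A) (c : nat -> R).

(** Scalars act through [iota], so that the notion applies in the same way to [A] and to
    [{poly A}]. *)
Definition functional phi : Prop :=
  (forall a b, phi (a + b) = phi a + phi b) /\
  (forall r a, phi (iota r * a) = r * phi a).

Definition lincomb c L : A := \sum_(i < size L) iota (c i) * L`_i.

(** The reversed Cauchy-Schwarz inequality: on the span of the letters the form has at most one
    positive direction. *)
Definition hyperbolic phi L N : Prop := forall c1 c2,
  let v := lincomb c1 L in let w := lincomb c2 L in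
  0 < phi (w * w * N) ->
  phi (v * v * N) * phi (w * w * N) <= phi (v * w * N) ^+ 2.

(** The analogue of a strictly Lorentzian form of degree [e]: [phi] of a word plays the role of a
    mixed derivative, and words of length [e - 2] give the Hessians. *)
Definition lorentzian_functional (e : nat) phi L : Prop :=
  [/\ functional phi,
      forall s, {subset s <= L} -> size s = e -> 0 < phi (\prod_(a <- s) a) &
      forall s, {subset s <= L} -> (size s).+2 = e ->
        hyperbolic phi L (\prod_(a <- s) a)].

Definition poscomb L w : Prop :=
  exists c, (forall i, 0 < c i) /\ w = lincomb c L.

Lemma functional0 phi : functional phi -> phi 0 = 0.
Proof. by move=> [phiD _]; apply: (addrI (phi 0)); rewrite -phiD !addr0. Qed.

Lemma functional_sum phi (I : Type) (r : seq I) (P : pred I) (F : I -> A) :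
  functional phi -> phi (\sum_(i <- r | P i) F i) = \sum_(i <- r | P i) phi (F i).
Proof. by move=> h; apply: (big_morph phi h.1 (functional0 h)). Qed.

Lemma functional_lincomb phi c L N : functional phi ->
  phi (lincomb c L * N) = \sum_(i < size L) c i * phi (L`_i * N).
Proof.
move=> h; rewrite /lincomb mulr_suml functional_sum //.
by apply: eq_bigr => i _; rewrite -mulrA h.2.
Qed.

Lemma lincomb_cons c a L :
  lincomb c (a :: L) = iota (c 0) * a + lincomb (fun i => c i.+1) L.
Proof. by rewrite /lincomb /= big_ord_recl. Qed.

Lemma eq_lincomb c1 c2 L : c1 =1 c2 -> lincomb c1 L = lincomb c2 L.
Proof. by move=> h; apply: eq_bigr => i _; rewrite h. Qed.

Lemma lincombD c1 c2 L r1 r2 :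
  iota r1 * lincomb c1 L + iota r2 * lincomb c2 L =
  lincomb (fun i => r1 * c1 i + r2 * c2 i) L.
Proof.
rewrite /lincomb !mulr_sumr -big_split; apply: eq_bigr => i _ /=.
by rewrite rmorphD !rmorphM; ring.
Qed.

Lemma functional_quad phi r1 r2 v1 v2 N : functional phi ->
  let u := iota r1 * v1 + iota r2 * v2 in
  phi (u * u * N) = r1 ^+ 2 * phi (v1 * v1 * N) +
     2 * r1 * r2 * phi (v1 * v2 * N) + r2 ^+ 2 * phi (v2 * v2 * N).
Proof.
move=> h u.
have -> : u * u * N = iota (r1 ^+ 2) * (v1 * v1 * N) +
   iota (2 * r1 * r2) * (v1 * v2 * N) + iota (r2 ^+ 2) * (v2 * v2 * N).
  by rewrite /u !expr2 !rmorphM /= rmorph_nat; ring.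
by rewrite !h.1 !h.2.
Qed.

Lemma functional_bil phi r1 r2 v1 v2 w N : functional phi ->
  phi ((iota r1 * v1 + iota r2 * v2) * w * N) =
  r1 * phi (v1 * w * N) + r2 * phi (v2 * w * N).
Proof.
move=> h; have -> : (iota r1 * v1 + iota r2 * v2) * w * N =
  iota r1 * (v1 * w * N) + iota r2 * (v2 * w * N) by ring.
by rewrite h.1 !h.2.
Qed.

(** One reference vector [w] of positive square suffices: the combination of [v1] and [v2] with
    weights [s] and [t] is orthogonal to [w], hence has square at most 0, and completing the square
    after multiplying by [c] gives the claim. *)
Lemma hyperbolic_at phi L N w : functional phi -> 0 < phi (w * w * N) ->
  (forall c, let v := lincomb c L in
     phi (v * v * N) * phi (w * w * N) <= phi (v * w * N) ^+ 2) ->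
  hyperbolic phi L N.
Proof.
move=> h ww0 hw c1 c2 /= cgt0; set v1 := lincomb c1 L in cgt0 *; set v2 := lincomb c2 L in cgt0 *.
set a := phi (v1 * v1 * N); set b := phi (v1 * v2 * N); set c := phi (v2 * v2 * N) in cgt0 *.
pose s := phi (v2 * w * N); pose t := - phi (v1 * w * N).
have := hw (fun i => s * c1 i + t * c2 i); rewrite -lincombD -/v1 -/v2 /=.
rewrite functional_quad // functional_bil // -/a -/b -/c -/s.
have -> : s * phi (v1 * w * N) + t * s = 0 by rewrite /t; ring.
rewrite expr0n /= pmulr_lle0 // => neg.
have s2 : 0 < s ^+ 2.
  by apply: lt_le_trans (hw c2); rewrite mulr_gt0.
rewrite leNgt; apply/negP => abc.
have : 0 < c * (s ^+ 2 * a + 2 * s * t * b + t ^+ 2 * c).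
  have -> : c * (s ^+ 2 * a + 2 * s * t * b + t ^+ 2 * c) =
    (t * c + s * b) ^+ 2 + s ^+ 2 * (a * c - b ^+ 2) by ring.
  by rewrite ltr_wpDl ?sqr_ge0 // mulr_gt0 // subr_gt0.
by rewrite pmulr_rgt0 // ltNge neg.
Qed.

Lemma hyperbolic_bochner phi L x w M (hub : 'I_(size L)) : functional phi ->
  (forall i, 0 < x i) -> w = lincomb x L ->
  (forall i j : 'I_(size L), i != j -> 0 <= phi (L`_i * L`_j * (w * M))) ->
  (forall j : 'I_(size L), j != hub -> 0 < phi (L`_hub * L`_j * (w * M))) ->
  (forall i : 'I_(size L), 0 < phi (w * w * (L`_i * M))) ->
  (forall i : 'I_(size L), hyperbolic phi L (L`_i * M)) ->
  hyperbolic phi L (w * M).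
Proof.
move=> h x0 wE off hubP pos hyp.
pose H (i j : 'I_(size L)) := phi (L`_i * L`_j * (w * M)).
pose X (i : 'I_(size L)) := x i.
have appE c i : mxapp H (fun i => c (val i)) i = phi (lincomb c L * w * (L`_i * M)).
  rewrite /mxapp -!mulrA functional_lincomb //; apply: eq_bigr => j _; rewrite mulrC.
  by congr (_ * phi _); ring.
have dotE c1 c2 : dot (fun i : 'I_(size L) => c1 (val i)) (mxapp H (fun i => c2 (val i))) =
    phi (lincomb c1 L * lincomb c2 L * (w * M)).
  rewrite -mulrA functional_lincomb //; apply: eq_bigr => j _; rewrite appE.
  by congr (_ * phi _); ring.
have appX i : mxapp H X i = phi (w * w * (L`_i * M)) by rewrite appE -wE.
have wgt0 : 0 < phi (w * w * (w * M)).
  have -> : w * w * (w * M) = w * (w * w * M) by ring.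
  rewrite {1}wE functional_lincomb // (bigD1 hub) //= ltr_pwDl //.
    by rewrite mulr_gt0 // (_ : L`_hub * _ = w * w * (L`_hub * M)) //; ring.
  apply: sumr_ge0 => i _; apply: mulr_ge0; first exact/ltW/x0.
  apply: ltW.
  by rewrite (_ : L`_i * _ = w * w * (L`_i * M)) //; ring.
apply: hyperbolic_at (wgt0) _ => // c /=.
have := @bochner_hyperbolic R _ H X _ off hub hubP (fun i => x0 i) _ _ (fun i => c (val i)).
rewrite !dotE -wE; apply.
- by move=> i j; rewrite /H; congr phi; ring.
- by move=> i; rewrite appX.
- move=> v; pose c' i := oapp v 0 (insub i : option 'I_(size L)).
  have vE i : v i = c' (val i) by rewrite /c' valK.
  have vE' : dot v (mxapp H v) = dot (fun i : 'I_(size L) => c' (val i)) (mxapp H (fun i => c' (val i))).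
    rewrite /dot; apply: eq_bigr => i _; rewrite vE; congr (_ * _).
    by apply: eq_bigr => j _; rewrite vE.
  rewrite vE' dotE.
  have -> : lincomb c' L * lincomb c' L * (w * M) = w * (lincomb c' L * lincomb c' L * M) by ring.
  rewrite {1}wE functional_lincomb //; apply: ler_sum => i _.
  have -> : mxapp H v i = phi (lincomb c' L * w * (L`_i * M)).
    by rewrite -appE; apply: eq_bigr => j _; rewrite vE.
  rewrite appX [_ ^+ 2 * _]mulrC -[X in _ <= X]mulrA ler_pM2l // ler_pdivlMr //.
  have := hyp i c' x; rewrite -wE => /(_ (pos i)).
  by rewrite (_ : L`_i * (_ * _ * M) = lincomb c' L * lincomb c' L * (L`_i * M)) //; ring.
Qed.

Lemma lorentzian_pos_poscomb e phi L s ws : (0 < size L)%N ->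
  lorentzian_functional e phi L -> {subset s <= L} ->
  (forall w, w \in ws -> poscomb L w) -> (size s + size ws)%N = e ->
  0 < phi (\prod_(a <- s) a * \prod_(a <- ws) a).
Proof.
move=> L0 [h pos _]; elim: ws s => [|w ws IH] s sL wsP sz.
  by rewrite big_nil mulr1; apply: pos; rewrite // -sz addn0.
have [c [c0 wE]] := wsP w (mem_head _ _).
rewrite big_cons mulrCA wE functional_lincomb //.
have term i : (i < size L)%N -> 0 < c i * phi (L`_i * (\prod_(a <- s) a * \prod_(a <- ws) a)).
  move=> iL; rewrite mulr_gt0 // mulrA (prod_seq_cons L`_i s) IH //.
  - by move=> a; rewrite inE => /orP[/eqP ->|/sL //]; rewrite mem_nth.
  - by move=> a aws; apply: wsP; rewrite inE aws orbT.
  - by rewrite -sz /= addnS.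
rewrite (bigD1 (Ordinal L0)) //= ltr_pwDl ?term //.
by apply: sumr_ge0 => i _; rewrite ltW ?term.
Qed.

(** Induction on [ws]: the Bochner argument reduces the factor [w] to a letter in its place, which
    moves to [s] and leaves a shorter [ws]. *)
Lemma lorentzian_hyperbolic_poscomb e phi L s ws : (0 < size L)%N ->
  lorentzian_functional e phi L -> {subset s <= L} ->
  (forall w, w \in ws -> poscomb L w) -> (size s + size ws).+2 = e ->
  hyperbolic phi L (\prod_(a <- s) a * \prod_(a <- ws) a).
Proof.
move=> L0 lor; have [h pos hyp] := lor.
elim: ws s => [|w ws IH] s sL wsP sz.
  by rewrite big_nil mulr1; apply: hyp; rewrite // -sz addn0.
have wP := wsP w (mem_head _ _); have [c [c0 wE]] := wP.
have wsP' a : a \in ws -> poscomb L a by move=> aws; apply: wsP; rewrite inE aws orbT.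
have consL a s' : a \in L -> {subset s' <= L} -> {subset a :: s' <= L}.
  by move=> aL s'L b; rewrite inE => /orP[/eqP ->|/s'L].
have wpos s' ws' : {subset s' <= L} -> (forall w, w \in ws' -> poscomb L w) ->
    (size s' + size ws')%N = e -> 0 < phi (\prod_(a <- s') a * \prod_(a <- ws') a).
  exact: lorentzian_pos_poscomb.
have off (i j : 'I_(size L)) :
    0 < phi (L`_i * L`_j * (w * (\prod_(a <- s) a * \prod_(a <- ws) a))).
  have := @wpos [:: L`_i, L`_j & s] (w :: ws); rewrite !big_cons -sz /= => H.
  rewrite (_ : _ * _ = L`_i * (L`_j * \prod_(j <- s) j) * (w * \prod_(j <- ws) j)); last by ring.
  by apply: H => //; apply: (consL); rewrite ?mem_nth //; apply: (consL); rewrite ?mem_nth.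
rewrite big_cons mulrCA.
apply: (@hyperbolic_bochner _ _ c _ _ (Ordinal L0)) => //.
- by move=> i j _; exact/ltW/off.
- move=> i; have := @wpos (L`_i :: s) [:: w, w & ws]; rewrite !big_cons -sz /= => H.
  rewrite (_ : _ * _ = L`_i * \prod_(j <- s) j * (w * (w * \prod_(j <- ws) j))); last by ring.
  apply: H; rewrite ?addnS //; first by apply: (consL); rewrite ?mem_nth.
  by move=> a; rewrite !inE => /or3P[/eqP ->|/eqP ->|/wsP'].
- move=> i; rewrite mulrA (prod_seq_cons L`_i s); apply: IH => //; last by rewrite -sz /= addnS.
  by apply: (consL); rewrite ?mem_nth.
Qed.

(** Polynomial dependence on the perturbation [r] lets weak inequalities pass to [r = 0]. *)
Lemma functional_prod_perturb phi a s om : functional phi ->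
  exists P : {poly R}, forall r, P.[r] = phi (a * \prod_(b <- s) (b + iota r * om)).
Proof.
move=> h; elim: s a => [|b s IH] a.
  by exists (phi a)%:P => r; rewrite big_nil mulr1 hornerC.
have [P1 P1E] := IH (a * b); have [P2 P2E] := IH (a * om).
exists (P1 + 'X * P2) => r; rewrite big_cons hornerD hornerM hornerX P1E P2E -h.2 -h.1.
by congr phi; ring.
Qed.

End Functional.

Lemma hyperbolic_pullback (R : realFieldType) (A B : comNzRingType)
    (iA : {rmorphism R -> A}) (iB : {rmorphism R -> B}) (phi : A -> R) (psi : B -> R)
    L L' N N' (f : (nat -> R) -> nat -> R) :
  (forall c d, psi (lincomb iB c L' * lincomb iB d L' * N') =
               phi (lincomb iA (f c) L * lincomb iA (f d) L * N)) ->
  hyperbolic iA phi L N -> hyperbolic iB psi L' N'.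
Proof. by move=> h hyp c d /=; rewrite !h; apply: hyp. Qed.

Lemma poly_ge0_at0 (R : realFieldType) (P : {poly R}) :
  (forall r, 0 < r -> 0 <= P.[r]) -> 0 <= P.[0].
Proof.
move=> h; rewrite leNgt; apply/negP => P0.
have [Q PE] : exists Q, P = P.[0]%:P + 'X * Q.
  have /factor_theorem[Q QE] : root (P - P.[0]%:P) 0.
    by rewrite rootE !hornerE subrr.
  by exists Q; rewrite mulrC -[X in _ * X](subr0 'X) -polyC0 -QE addrC subrK.
have [b bP] := poly_itv_bound Q 0 1.
(* Small enough that [r * Q.[r]] is at most half of [- P.[0]], which keeps [P.[r]] negative. *)
pose r := Num.min 1 (- P.[0] / (2 * (`|b| + 1))).
have b1 : 0 < `|b| + 1 by rewrite ltr_wpDl.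
have r0 : 0 < r by rewrite lt_min ltr01 divr_gt0 ?mulr_gt0 // oppr_gt0.
have r1 : r <= 1 by rewrite ge_min lexx.
have r2 : r * (2 * (`|b| + 1)) <= - P.[0].
  by rewrite -ler_pdivlMr ?mulr_gt0 // ge_min lexx orbT.
have := h r r0; rewrite PE !hornerE leNgt => /negP; apply.
have Qr : Q.[r] <= `|b| + 1.
  apply: le_trans (ler_norm _) _; apply: le_trans (bP r _) _.
    by rewrite r1 ltW.
  by apply: le_trans (ler_norm _) _; rewrite lerDl.
have : r * Q.[r] <= r * (`|b| + 1) by rewrite ler_pM2l.
by move: r2; rewrite mulrCA; nra.
Qed.

(** * Merging two letters *)

Section DividedDifference.
Variables (A : comNzRingType) (x1 x2 : A).
Implicit Types (q : {poly A}).

(** The complete homogeneous polynomial of degree [i - 1] in [x1] and [x2], and 0 for [i = 0]: the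
    divided difference of the [i]-th power. *)
Fixpoint hsum2 (i : nat) : A := if i is j.+1 then x2 ^+ j + x1 * hsum2 j else 0.

Lemma hsum2_sym i : hsum2 i.+1 = x1 ^+ i + x2 * hsum2 i.
Proof.
elim: i => [|i IH]; first by rewrite /= !mulr0.
transitivity (x2 ^+ i.+1 + x1 * hsum2 i.+1) => //.
rewrite {1}IH -[hsum2 i.+1]/(x2 ^+ i + x1 * hsum2 i) !exprS; ring.
Qed.

(** The quotient of [q.[x1] - q.[x2]] by [x1 - x2], defined on coefficients so as to make sense in
    any ring. *)
Definition divdiff q : A := \sum_(i < size q) q`_i * hsum2 i.

Lemma divdiffE n q : (size q <= n)%N -> divdiff q = \sum_(i < n) q`_i * hsum2 i.
Proof.
move=> le; rewrite /divdiff (big_ord_widen n (fun i => q`_i * hsum2 i) le).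
rewrite big_mkcond /=; apply: eq_bigr => i _; case: ltnP => // h.
by rewrite nth_default // mul0r.
Qed.

Lemma divdiffD q r : divdiff (q + r) = divdiff q + divdiff r.
Proof.
pose n := (size (q + r)%R + size q + size r)%N.
rewrite !(@divdiffE n) /n; first by rewrite -big_split; apply: eq_bigr => i _; rewrite coefD mulrDl.
all: lia.
Qed.

Lemma divdiffCM a q : divdiff (a%:P * q) = a * divdiff q.
Proof.
pose n := (size (a%:P * q)%R + size q)%N.
rewrite !(@divdiffE n) /n ?leq_addl ?leq_addr //.
by rewrite mulr_sumr; apply: eq_bigr => i _; rewrite coefCM mulrA.
Qed.

Lemma divdiffMX q : divdiff ('X * q) = q.[x2] + x1 * divdiff q.
Proof.
have le : (size ('X * q)%R <= (size q).+1)%N.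
  by rewrite (leq_trans (size_polyMleq _ _)) // size_polyX.
rewrite (divdiffE le) big_ord_recl /= mulr0 add0r horner_coef mulr_sumr -big_split.
by apply: eq_bigr => i _ /=; rewrite coefXM /=; ring.
Qed.

Lemma divdiffMX_sym q : divdiff ('X * q) = q.[x1] + x2 * divdiff q.
Proof.
have le : (size ('X * q)%R <= (size q).+1)%N.
  by rewrite (leq_trans (size_polyMleq _ _)) // size_polyX.
rewrite (divdiffE le) big_ord_recl /= mulr0 add0r horner_coef mulr_sumr -big_split.
by apply: eq_bigr => i _; rewrite coefXM -/(hsum2 _.+1) hsum2_sym /=; ring.
Qed.

Lemma divdiff_XsubC1 q : divdiff (('X - x1%:P) * q) = q.[x2].
Proof. by rewrite mulrBl divdiffD divdiffMX -mulNr -polyCN divdiffCM; ring. Qed.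

Lemma divdiff_XsubC2 q : divdiff (('X - x2%:P) * q) = q.[x1].
Proof. by rewrite mulrBl divdiffD divdiffMX_sym -mulNr -polyCN divdiffCM; ring. Qed.

Lemma divdiffC a : divdiff a%:P = 0.
Proof. by rewrite (divdiffE (size_polyC_leq1 a)) big_ord1 mulr0. Qed.

Lemma divdiffXn i : divdiff 'X^i = hsum2 i.
Proof.
elim: i => [|i IH]; first by rewrite expr0 -polyC1 divdiffC.
by rewrite exprS divdiffMX hornerXn IH.
Qed.

End DividedDifference.

Section Merge.
Variables (R : realFieldType) (A : comNzRingType) (iota : {rmorphism R -> A}).

Definition iotaP : {rmorphism R -> {poly A}} := polyC \o iota.

Lemma lincomb_map_polyC c L : lincomb iotaP c (map polyC L) = (lincomb iota c L)%:P.
Proof.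
rewrite /lincomb size_map rmorph_sum; apply: eq_bigr => i _ /=.
by rewrite (nth_map 0) // polyCM.
Qed.

Variables (phi : A -> R) (x1 x2 : A) (xs : seq A) (e : nat).
Let X := [:: x1, x2 & xs].
Hypothesis lor : lorentzian_functional iota e phi X.
Let h : functional iota phi. Proof. by case: lor. Qed.

(** This functional pairs with degree [e + 1], one more than [phi]; [merged_functional] spends a
    factor ['X] to return to degree [e]. *)
Definition divdiff_functional (q : {poly A}) : R := phi (divdiff x1 x2 q).
Notation V := divdiff_functional.

Definition merged_functional (q : {poly A}) : R := V ('X * q).

(* [D1] and [D2] play the role of two disjoint divisors: restricting [V] to
   [D1] (resp. [D2]) is the evaluation at [x2] (resp. [x1]) followed by [phi]. *)
Let D1 : {poly A} := 'X - x1%:P.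
Let D2 : {poly A} := 'X - x2%:P.
(** [LD] contains the boundary divisors and carries the Bochner argument; positivity is stated for
    positive combinations of [LZ]. *)
Let LD := [:: D1, D2 & map polyC X].
Let LZ := 'X :: map polyC X.

Let hV : functional iotaP V.
Proof.
split=> [a b|r a]; first by rewrite /V divdiffD h.1.
by rewrite /V divdiffCM h.2.
Qed.

Let V_D1 q : V (D1 * q) = phi q.[x2]. Proof. by rewrite /V divdiff_XsubC1. Qed.
Let V_D2 q : V (D2 * q) = phi q.[x1]. Proof. by rewrite /V divdiff_XsubC2. Qed.

Let lincomb_LZ c : lincomb iotaP c LZ =
  (iota (c 0))%:P * 'X + (lincomb iota (fun i => c i.+1) X)%:P.
Proof. by rewrite lincomb_cons lincomb_map_polyC. Qed.

Let lincomb_LD c : lincomb iotaP c LD = (iota (c 0 + c 1))%:P * 'X +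
  (lincomb iota (fun i => c i.+2) X - iota (c 0) * x1 - iota (c 1) * x2)%:P.
Proof.
rewrite !lincomb_cons lincomb_map_polyC /D1 /D2 /=.
by rewrite !polyCD !polyCN !polyCM rmorphD polyCD; ring.
Qed.

Let horner_lincomb_LZ c b : exists c', lincomb iota c' X =
   (lincomb iotaP c LZ).[if b then x1 else x2] /\ ((forall i, 0 < c i) -> forall i, 0 < c' i).
Proof.
exists (fun i => (if i == (if b then 0 else 1)%N then c 0 else 0) + c i.+1).
split; last by move=> h0 i; case: ifP => _; rewrite ?add0r ?addr_gt0.
rewrite lincomb_LZ !hornerE !lincomb_cons.
rewrite (@eq_lincomb _ _ iota _ (fun i => c i.+3)); last by case: b => i; rewrite /= add0r.
by case: b; rewrite /= ?rmorphD rmorph0; ring.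
Qed.

Let poscomb_horner w b : poscomb iotaP LZ w -> poscomb iota X w.[if b then x1 else x2].
Proof.
move=> [c [c0 ->]]; have [c' [<- c'0]] := horner_lincomb_LZ c b.
by exists c'; split=> //; exact: c'0.
Qed.

Let poscomb_LD w : poscomb iotaP LZ w ->
  exists c, (forall i, 0 < c i) /\ w = lincomb iotaP c LD.
Proof.
move=> [c [c0 ->]].
(* Splits ['X] as half of [D1 + x1] plus half of [D2 + x2], which keeps all coefficients
   positive. *)
exists (fun i => if (i < 2)%N then c 0 / 2 else if (i < 4)%N then c i.-1 + c 0 / 2 else c i.-1).
split.
  by move=> i; case: ifP => _; [|case: ifP => _]; rewrite ?addr_gt0 ?divr_gt0.
rewrite lincomb_LZ lincomb_LD /= !lincomb_cons /=.
have -> : c 0 / 2 + c 0 / 2 = c 0 by field.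
by congr (_ + _%:P); rewrite !rmorphD /=; ring.
Qed.

Let horner_prodC (s : seq A) (y : A) : (\prod_(a <- s) a%:P).[y] = \prod_(a <- s) a.
Proof. by rewrite horner_prod; apply: eq_bigr => a _; rewrite hornerC. Qed.

Let prodC_cons (a : A) s : a%:P * \prod_(b <- s) b%:P = \prod_(b <- a :: s) b%:P.
Proof. by rewrite big_cons. Qed.

Let consX a s : a \in X -> {subset s <= X} -> {subset a :: s <= X}.
Proof. by move=> aX sX b; rewrite inE => /orP[/eqP ->|/sX]. Qed.

Let pos_restr (s : seq A) ws b : {subset s <= X} ->
  (forall w, w \in ws -> poscomb iotaP LZ w) -> (size s + size ws)%N = e ->
  0 < phi (\prod_(a <- s) a%:P * \prod_(a <- ws) a).[if b then x1 else x2].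
Proof.
move=> sX wsP sz; rewrite hornerM horner_prodC horner_prod.
rewrite -(big_map (fun w : {poly A} => w.[if b then x1 else x2]) xpredT idfun) /=.
apply: (lorentzian_pos_poscomb _ lor) => //; last by rewrite size_map.
by move=> a /mapP[w /wsP wP ->]; exact: poscomb_horner.
Qed.

(** One factor is expanded over [LD]: [D1] and [D2] reduce to [phi], and a constant letter moves to
    [s]. Since [V] kills constants, [ws] must be nonempty, and when one factor is left only its ['X]
    part survives. *)
Let posV (s : seq A) ws : {subset s <= X} ->
  (forall w, w \in ws -> poscomb iotaP LZ w) -> (0 < size ws)%N ->
  (size s + size ws)%N = e.+1 ->
  0 < V (\prod_(a <- s) a%:P * \prod_(a <- ws) a).
Proof.
elim: ws s => [//|w ws IH] s sX wsP _ sz.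
have wsP' a : a \in ws -> poscomb iotaP LZ a by move=> aws; apply: wsP; rewrite inE aws orbT.
have wP := wsP w (mem_head _ _).
case: ws IH wsP sz wsP' => [|w' ws] IH wsP sz wsP'.
  have [c [c0 ->]] := wP; rewrite big_seq1 lincomb_LZ -rmorph_prod mulrDr.
  rewrite -polyCM hV.1 [X in _ + X](_ : _ = 0) ?addr0; last first.
    by rewrite /V divdiffC (functional0 h).
  rewrite mulrCA -[(iota _)%:P]/(iotaP (c 0)) hV.2 mulr_gt0 // /V divdiffCM.
  rewrite -['X]expr1 divdiffXn /= expr0 mulr0 addr0 mulr1.
  by case: lor => _ pos _; apply: pos => //; move: sz => /=; lia.
have [c [c0 wE]] := poscomb_LD wP.
rewrite big_cons mulrCA wE (functional_lincomb _ _ _ hV).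
have term i : (i < size LD)%N ->
    0 < c i * V (LD`_i * (\prod_(a <- s) a%:P * \prod_(a <- (w' :: ws)) a)).
  move=> iL; rewrite mulr_gt0 //; case: i iL => [|[|i]] iL.
  - by rewrite /= V_D1; apply: (@pos_restr _ _ false) => //; move: sz => /=; lia.
  - by rewrite /= V_D2; apply: (@pos_restr _ _ true) => //; move: sz => /=; lia.
  - have iX : (i < size X)%N by move: iL; rewrite /= size_map.
    rewrite -[LD`_i.+2]/((map polyC X)`_i) (nth_map 0) // mulrA prodC_cons.
    apply: IH => //; first by apply: consX; rewrite ?mem_nth.
    by move: sz => /=; lia.
rewrite (bigD1 ord0) //= ltr_pwDl ?(term 0%N) //.
by apply: sumr_ge0 => i _; rewrite ltW ?term.
Qed.

(** Coefficients over [X] after ['X] is replaced by [x1] or [x2]: one divisor vanishes, the other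
    becomes plus or minus [x1 - x2]. *)
Let horner_LD b c i : R :=
  c i.+2 + (if b then c 1 else - c 0) * ((i == 0)%:R - (i == 1)%:R).

Let horner_lincomb_LD b c :
  (lincomb iotaP c LD).[if b then x1 else x2] = lincomb iota (horner_LD b c) X.
Proof.
rewrite lincomb_LD !hornerE !lincomb_cons.
rewrite -(@eq_lincomb _ _ iota (fun i => c i.+4)); last first.
  by move=> i; rewrite /horner_LD /= subrr mulr0 addr0.
by rewrite /horner_LD /= subr0 sub0r mulrN !mulr1; case: b; rewrite !rmorphD !rmorphN /=; ring.
Qed.

Let hyp_restr (s : seq A) ws b : {subset s <= X} ->
  (forall w, w \in ws -> poscomb iotaP LZ w) -> (size s + size ws).+2 = e ->
  hyperbolic iotaP V LD
    ((if b then D2 else D1) * (\prod_(a <- s) a%:P * \prod_(a <- ws) a)).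
Proof.
move=> sX wsP sz; pose y := if b then x1 else x2.
apply: (@hyperbolic_pullback _ _ _ iota _ phi _ X _
  (\prod_(a <- s) a * \prod_(a <- map (fun w : {poly A} => w.[y]) ws) a) _ (horner_LD b)).
  move=> c d; rewrite mulrCA -!horner_lincomb_LD big_map /=.
  by rewrite /y; case: (b); rewrite ?V_D1 ?V_D2 !hornerM horner_prodC horner_prod.
apply: (lorentzian_hyperbolic_poscomb _ lor) => //; last by rewrite size_map.
by move=> a /mapP[w /wsP wP ->]; exact: poscomb_horner.
Qed.

(** Induction on [ws]. If it is empty, the form is a symmetrized product of two linear forms.
    Otherwise the Bochner argument over [LD] replaces one factor by [D1] or [D2], where [V]
    restricts to [phi], or by a constant letter, where induction applies. *)
Let hypV (s : seq A) ws : {subset s <= X} ->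
  (forall w, w \in ws -> poscomb iotaP LZ w) -> (size s + size ws).+1 = e ->
  hyperbolic iotaP V LD (\prod_(a <- s) a%:P * \prod_(a <- ws) a).
Proof.
elim: ws s => [|w ws IH] s sX wsP sz.
  rewrite big_nil mulr1 -rmorph_prod; set a := \prod_(a <- s) a => c d /= _.
  rewrite !lincomb_LD; move: (c 0 + c 1) (d 0 + d 1) (_ - _ - _) (_ - _ - _) => z1 z2 l2 l1.
  have VE z l z' l' : V (((iota z)%:P * 'X + l%:P) * ((iota z')%:P * 'X + l'%:P) * a%:P) =
     z * (phi (l' * a) + z' / 2 * phi ((x1 + x2) * a)) +
     z' * (phi (l * a) + z / 2 * phi ((x1 + x2) * a)).
    have -> : ((iota z)%:P * 'X + l%:P) * ((iota z')%:P * 'X + l'%:P) * a%:P =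
      (iotaP (z * z')) * (a%:P * 'X^2) + iotaP z * ((l' * a)%:P * 'X^1) +
      iotaP z' * ((l * a)%:P * 'X^1) + (l * l' * a)%:P.
      by rewrite /iotaP /= rmorphM !polyCM; ring.
    rewrite !hV.1 !hV.2 /V divdiffC (functional0 h) !divdiffCM !divdiffXn /=.
    rewrite !mulr0 !addr0 expr0 !mulr1 expr1 [a * _]mulrC [x2 + x1]addrC; by field.
  rewrite !VE.
  (* The polarized form is [z1 * p2 + z2 * p1], so the difference of the two sides is a square. *)
  set p1 := phi (l1 * a) + _; set p2 := phi (l2 * a) + _.
  rewrite -subr_ge0 (_ : _ - _ = (z1 * p2 - z2 * p1) ^+ 2) ?sqr_ge0 //; ring.
have wsP' a : a \in ws -> poscomb iotaP LZ a by move=> aws; apply: wsP; rewrite inE aws orbT.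
have wP := wsP w (mem_head _ _); have [c [c0 wE]] := poscomb_LD wP.
have szX i : (i.+2 < size LD)%N -> (i < size X)%N by rewrite /= size_map.
have LDi i : (i.+2 < size LD)%N -> LD`_i.+2 = (X`_i)%:P.
  by move=> /szX iX; rewrite -[LD`_i.+2]/((map polyC X)`_i) (nth_map 0).
set M := \prod_(a <- s) a%:P * \prod_(a <- ws) a.
have offX b i : (i < size X)%N -> 0 < phi ((X`_i)%:P * (w * M)).[if b then x1 else x2].
  move=> iX; have := @pos_restr (X`_i :: s) (w :: ws) b; rewrite !big_cons => H.
  rewrite (_ : _ * (w * M) = (X`_i)%:P * \prod_(j <- s) j%:P * (w * \prod_(j <- ws) j)); last by rewrite /M; ring.
  by apply: H => //; apply: consX; rewrite ?mem_nth.
have offXX i j : (i < size X)%N -> (j < size X)%N -> 0 < V ((X`_i)%:P * (X`_j)%:P * (w * M)).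
  move=> iX jX; have := @posV [:: X`_i, X`_j & s] (w :: ws); rewrite !big_cons => H.
  rewrite (_ : _ * (w * M) = (X`_i)%:P * ((X`_j)%:P * \prod_(j <- s) j%:P) * (w * \prod_(j <- ws) j)); last by rewrite /M; ring.
  apply: H => //; last by rewrite -sz.
  by apply: consX; rewrite ?mem_nth //; apply: consX; rewrite ?mem_nth.
have offb b i : (i.+2 < size LD)%N -> 0 < V ((if b then D2 else D1) * LD`_i.+2 * (w * M)).
  move=> iL; rewrite LDi // -mulrA; have := offX b _ (szX _ iL).
  by case: b; rewrite ?V_D1 ?V_D2.
have wwM b : 0 < phi (w * w * M).[if b then x1 else x2].
  have := @pos_restr s [:: w, w & ws] b; rewrite !big_cons => H.
  rewrite (_ : _ * M = \prod_(j <- s) j%:P * (w * (w * \prod_(j <- ws) j))); last by rewrite /M; ring.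
  apply: H => //; last by rewrite -sz /=; lia.
  by move=> a; rewrite !inE => /or3P[/eqP ->|/eqP ->|/wsP'].
rewrite big_cons mulrCA -/M.
(* The hub is the letter [x1]: [D1] and [D2] are disjoint and not joined to each other, while [x1]
   meets every letter. *)
have hubP : (2 < size LD)%N by [].
apply: (@hyperbolic_bochner _ _ _ _ _ c _ _ (Ordinal hubP)) => //.
- move=> [[|[|i]] iL] [[|[|j]] jL] // _.
  + by rewrite -mulrA V_D1 hornerM hornerXsubC subrr mul0r (functional0 h).
  + apply: ltW; exact: (offb false _ jL).
  + by rewrite -mulrA V_D2 hornerM hornerXsubC subrr mul0r (functional0 h).
  + apply: ltW; exact: (offb true _ jL).
  + by rewrite [X in V (X * _)]mulrC; apply: ltW; exact: (offb false _ iL).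
  + by rewrite [X in V (X * _)]mulrC; apply: ltW; exact: (offb true _ iL).
  + by rewrite !LDi // ltW // offXX ?szX.
- move=> [[|[|j]] jL] // _.
  + by rewrite [X in V (X * _)]mulrC; exact: (offb false 0%N).
  + by rewrite [X in V (X * _)]mulrC; exact: (offb true 0%N).
  + by rewrite !LDi // offXX ?szX.
- move=> [[|[|i]] iL].
  + by rewrite mulrCA V_D1; apply: (wwM false).
  + by rewrite mulrCA V_D2; apply: (wwM true).
  + have := @posV (X`_i :: s) [:: w, w & ws]; rewrite LDi // !big_cons => H.
    rewrite (_ : w * w * _ = (X`_i)%:P * \prod_(j <- s) j%:P * (w * (w * \prod_(j <- ws) j))); last by rewrite /M; ring.
    apply: H => //; last by rewrite -sz /=; lia.
      by apply: consX; rewrite ?mem_nth ?szX.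
    by move=> a; rewrite !inE => /or3P[/eqP ->|/eqP ->|/wsP'].
- move=> [[|[|i]] iL].
  + by apply: (@hyp_restr _ _ false) => //; rewrite -sz addnS.
  + by apply: (@hyp_restr _ _ true) => //; rewrite -sz addnS.
  + rewrite LDi // mulrA prodC_cons; apply: IH => //; last by rewrite -sz /= addnS.
    by apply: consX; rewrite ?mem_nth ?szX.
Qed.

Let pos_hsum (t : seq A) m : {subset t <= X} -> (size t + m)%N = e ->
  0 < phi (\prod_(a <- t) a * hsum2 x1 x2 m.+1).
Proof.
have [_ pos _] := lor.
elim: m t => [|m IH] t tX sz.
  by rewrite /= mulr0 addr0 expr0 mulr1; apply: pos => //; rewrite -sz addn0.
rewrite -[hsum2 _ _ m.+2]/(x2 ^+ m.+1 + x1 * hsum2 x1 x2 m.+1) mulrDr h.1 addr_gt0 //.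
  have := pos (nseq m.+1 x2 ++ t).
  rewrite big_cat big_nseq iter_mulr_1 /= mulrC; apply.
    move=> a; rewrite -[_ :: _]/(nseq m.+1 x2 ++ t) mem_cat => /orP[|/tX //].
    by rewrite mem_nseq => /andP[_ /eqP ->]; rewrite !inE eqxx orbT.
  by rewrite size_cat size_nseq -sz; lia.
rewrite mulrA [_ * x1]mulrC prod_seq_cons; apply: IH; last by rewrite -sz /= addnS.
by apply: consX => //; rewrite mem_head.
Qed.

Let posVX (s : seq {poly A}) (t : seq A) m : {subset s <= LZ} -> {subset t <= X} ->
  (size s + size t + m)%N = e ->
  0 < V ('X ^+ m.+1 * \prod_(a <- t) a%:P * \prod_(a <- s) a).
Proof.
elim: s t m => [|a s IH] t m sL tX sz.
  rewrite big_nil mulr1 mulrC -rmorph_prod /V divdiffCM divdiffXn.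
  by apply: pos_hsum => //; rewrite -sz.
have sL' : {subset s <= LZ} by move=> b bs; apply: sL; rewrite inE bs orbT.
have := sL a (mem_head _ _); rewrite inE => /orP[/eqP aE|/mapP[b bX aE]].
  have := IH t m.+1 sL' tX; rewrite big_cons aE exprSr -!mulrA => H.
  by rewrite [X in _ * X]mulrCA; apply: H; rewrite -sz /=; lia.
have := IH (b :: t) m sL'; rewrite !big_cons aE => H.
rewrite (_ : _ * _ = 'X ^+ m.+1 * (b%:P * \prod_(j <- t) j%:P) * \prod_(j <- s) j); last by ring.
by apply: H; [exact: consX | rewrite -sz /=; lia].
Qed.

Lemma lorentzian_merge :
  lorentzian_functional iotaP e merged_functional ('X :: map polyC xs).
Proof.
have subL : {subset 'X :: map polyC xs <= LZ}.
  by move=> a; rewrite !inE => /orP[->//|->]; rewrite !orbT.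
split.
- by split=> [a b|r a]; rewrite /merged_functional ?mulrDr ?hV.1 // mulrCA hV.2.
- move=> s sL sz; rewrite /merged_functional.
  have := @posVX s [::] 0; rewrite big_nil expr1 mulr1; apply=> //; last by rewrite addn0 addn0.
  by move=> a /sL /subL.
move=> s sL sz.
(* A letter has zero coefficients on the other letters of [LZ]; adding [r * om] makes all of them
   positive, and [r] is then sent to 0. *)
pose om := lincomb iotaP (fun=> 1) LZ.
have sLZ : {subset 'X :: s <= LZ}.
  by move=> a; rewrite inE => /orP[/eqP ->|/sL/subL //]; rewrite mem_head.
pose N r := \prod_(b <- 'X :: s) (b + iotaP r * om).
have NE r : N r = \prod_(b <- map (fun b => b + iotaP r * om) ('X :: s)) b.
  by rewrite big_map.
have pc r b : 0 < r -> b \in LZ -> poscomb iotaP LZ (b + iotaP r * om).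
  move=> r0 bL; exists (fun i => (i == index b LZ)%:R + r); split.
    by move=> i; rewrite ltr_wpDl.
  have ib : (index b LZ < size LZ)%N by rewrite index_mem.
  have bE : b = lincomb iotaP (fun i => (i == index b LZ)%:R) LZ.
    rewrite /lincomb (bigD1 (Ordinal ib) isT) -[nat_of_ord (Ordinal ib)]/(index b LZ).
    rewrite eqxx rmorph1 mul1r nth_index // big1 => [|i]; first exact/esym/addr0.
    by rewrite -val_eqE => /negPf; rewrite -[\val (Ordinal ib)]/(index b LZ) => ->; rewrite rmorph0 mul0r.
  rewrite {1}bE -[X in X + _]mul1r -(rmorph1 iotaP) lincombD.
  by apply: eq_lincomb => i; rewrite mul1r mulr1.
have omP : poscomb iotaP LZ om by exists (fun=> 1).
have posN r : 0 < r -> 0 < V (om * om * N r).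
  move=> r0; rewrite NE -mulrA.
  have := @posV [::] [:: om, om & map (fun b => b + iotaP r * om) ('X :: s)].
  rewrite big_nil mul1r big_cons big_cons; apply=> //; last by rewrite /= size_map add0n -sz.
  move=> w; rewrite in_cons => /orP[/eqP -> //|]; rewrite in_cons => /orP[/eqP -> //|].
  by move=> /mapP[b /sLZ bL ->]; exact: pc.
have omLD : exists c, om = lincomb iotaP c LD by have [c [_ ->]] := poscomb_LD omP; exists c.
have hypN r : 0 < r -> hyperbolic iotaP V LD (N r).
  move=> r0; have := @hypV [::] (map (fun b => b + iotaP r * om) ('X :: s)).
  rewrite big_nil mul1r -NE; apply=> //; last by rewrite /= size_map -sz.
  by move=> w /mapP[b /sLZ bL ->]; exact: pc.
have N0 : N 0 = 'X * \prod_(b <- s) b.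
  rewrite /N big_cons rmorph0 mul0r addr0; congr (_ * _).
  by apply: eq_bigr => b _; rewrite addr0.
(* This positivity at [r = 0] lets [om] serve as the reference vector in the limit. *)
have pos0 : 0 < V (om * om * N 0).
  rewrite N0 -mulrA (functional_lincomb _ _ _ hV).
  have P2 (i j : 'I_(size LZ)) : 0 < V (LZ`_i * (LZ`_j * ('X * \prod_(b <- s) b))).
    have := @posVX [:: LZ`_i, LZ`_j & s] [::] 0; rewrite big_nil expr1 mulr1 !big_cons => H.
    rewrite (_ : _ * _ = 'X * (LZ`_i * (LZ`_j * \prod_(j <- s) j))); last by ring.
    apply: H => //; last by rewrite !addn0.
    move=> a; rewrite in_cons => /orP[/eqP ->|]; first by rewrite mem_nth.
    by rewrite in_cons => /orP[/eqP ->|/sL/subL //]; rewrite mem_nth.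
  have P1 (i : 'I_(size LZ)) : 0 < V (LZ`_i * (om * ('X * \prod_(b <- s) b))).
    rewrite mulrCA (functional_lincomb _ _ _ hV) (bigD1 ord0) //= ltr_pwDl //.
      by rewrite mul1r mulrCA; exact: (P2 i ord0).
    by apply: sumr_ge0 => j _; rewrite mul1r mulrCA ltW //; exact: (P2 i j).
  rewrite (bigD1 ord0) //= ltr_pwDl //; first by rewrite mul1r; exact: (P1 ord0).
  by apply: sumr_ge0 => j _; rewrite mul1r ltW //; exact: (P1 j).
have hyp0 : hyperbolic iotaP V LD (N 0).
  apply: (hyperbolic_at hV pos0) => c; set v := lincomb iotaP c LD.
  have [P1 P1E] := functional_prod_perturb (v * v) ('X :: s) om hV.
  have [P2 P2E] := functional_prod_perturb (om * om) ('X :: s) om hV.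
  have [P3 P3E] := functional_prod_perturb (v * om) ('X :: s) om hV.
  have := @poly_ge0_at0 _ (P3 ^+ 2 - P1 * P2).
  rewrite !hornerE P1E P2E P3E subr_ge0; apply=> r r0.
  rewrite !hornerE P1E P2E P3E subr_ge0.
  have [d dE] := omLD; have := hypN r r0 c d; rewrite -dE; apply; exact: posN.
(* The letters ['X] and [xs] are combinations of [LD], with ['X] equal to half of
   [D1 + D2 + x1 + x2]. *)
apply: (@hyperbolic_pullback _ _ _ iotaP _ V _ LD _ (N 0) _
  (fun c i => if (i < 2)%N then c 0 / 2 else if (i < 4)%N then c 0 / 2 else c i.-1.-2)) hyp0.
have lE c : lincomb iotaP c ('X :: map polyC xs) = lincomb iotaP
    (fun i => if (i < 2)%N then c 0 / 2 else if (i < 4)%N then c 0 / 2 else c i.-1.-2) LD.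
  rewrite lincomb_LD /= !lincomb_cons lincomb_map_polyC /=.
  have -> : c 0 / 2 + c 0 / 2 = c 0 by field.
  by congr (_ + _%:P); ring.
by move=> c d; rewrite /merged_functional !lE N0 mulrCA.
Qed.

End Merge.

(** * Complete homogeneous polynomials *)

Section CompleteHomogeneous.
Variable A : comNzRingType.

(** The complete homogeneous symmetric polynomial [h_m], by the recursion
    [h_m(y, ys) = h_m(ys) + y h_{m-1}(y, ys)]. *)
Fixpoint chom (ys : seq A) : nat -> A :=
  if ys is y :: ys' then
    fix F m := if m is m'.+1 then chom ys' m + y * F m' else 1
  else fun m => (m == 0)%:R.

Lemma chom0 ys : chom ys 0 = 1. Proof. by case: ys. Qed.

Lemma chomS y ys m :
  chom (y :: ys) m.+1 = chom ys m.+1 + y * chom (y :: ys) m.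
Proof. by []. Qed.

Lemma chom1 y m : chom [:: y] m = y ^+ m.
Proof. by elim: m => [|m IH]; rewrite // chomS IH /= add0r exprS. Qed.

End CompleteHomogeneous.

Lemma chom_map (A B : comNzRingType) (f : {rmorphism A -> B}) ys m :
  chom (map f ys) m = f (chom ys m).
Proof.
elim: ys m => [|y ys IH] m; first by rewrite /= rmorph_nat.
elim: m => [|m IHm]; first by rewrite !chom0 rmorph1.
by rewrite map_cons !chomS -map_cons IHm IH rmorphD rmorphM.
Qed.

Lemma horner_chom (A : comNzRingType) (ys : seq A) y m :
  (chom ('X :: map polyC ys) m).[y] = chom (y :: ys) m.
Proof.
elim: m => [|m IH]; first by rewrite !chom0 hornerC.
by rewrite !chomS (chom_map (polyC : {rmorphism A -> {poly A}})) hornerD hornerM hornerX hornerC IH.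
Qed.

(** The reason why merging keeps the sequence of interest: [merged_functional] on the polynomial in
    ['X] and [ys] equals [phi] on the one in [x1], [x2] and [ys]. *)
Lemma divdiff_chom (A : comNzRingType) (x1 x2 : A) ys m :
  divdiff x1 x2 ('X * chom ('X :: map polyC ys) m) = chom [:: x1, x2 & ys] m.
Proof.
have ddX : divdiff x1 x2 'X = 1 by rewrite -['X]expr1 divdiffXn /= mulr0 addr0.
elim: m => [|m IH]; first by rewrite !chom0 mulr1.
rewrite !chomS (chom_map (polyC : {rmorphism A -> {poly A}})) mulrDr divdiffD.
rewrite mulrC divdiffCM ddX mulr1 divdiffMX hornerM hornerX horner_chom IH; ring.
Qed.

(** The letters of [y :: ys] are merged two by two until one is left, which does not change [c].
    With only [y] and [z], the claim is hyperbolicity for the word [y ^+ (e - k.+2) * z ^+ k],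
    tested on the vectors [y] and [z]. *)
Lemma lorentzian_log_concave (R : realFieldType) (A : comNzRingType)
    (iota : {rmorphism R -> A}) phi (y : A) ys z e :
  lorentzian_functional iota e phi (y :: rcons ys z) ->
  let c k := phi (chom (y :: ys) (e - k) * z ^+ k) in
  (forall k, (k <= e)%N -> 0 < c k) /\
  (forall k, (k.+2 <= e)%N -> c k * c k.+2 <= c k.+1 ^+ 2).
Proof.
have [n sz] := ubnP (size ys).
elim: n A iota phi y ys z sz => [//|n IH] A iota phi y [|y' ys] z sz lor c; last first.
  have := @lorentzian_merge _ _ _ _ y y' _ _ lor.
  rewrite map_rcons => /IH; rewrite size_map => /(_ sz) /=.
  have cE k : merged_functional phi y y' (chom ('X :: map polyC ys) (e - k) * z%:P ^+ k) =
      phi (chom [:: y, y' & ys] (e - k) * z ^+ k).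
    rewrite /merged_functional /divdiff_functional mulrA mulrC -rmorphXn divdiffCM divdiff_chom.
    by rewrite mulrC.
  move=> [pos lc]; split=> k hk; first by have := pos k hk; rewrite cE /c.
  by have := lc k hk; rewrite !cE /c.
have [h pos hyp] := lor.
have prodE a b : \prod_(x <- nseq a y ++ nseq b z) x = y ^+ a * z ^+ b.
  by rewrite big_cat !big_nseq !iter_mulr_1.
have subE a b : {subset nseq a y ++ nseq b z <= [:: y; z]}.
  by move=> x; rewrite mem_cat !mem_nseq !inE => /orP[] /andP[_ ->]; rewrite ?orbT.
have posk k : (k <= e)%N -> 0 < phi (y ^+ (e - k) * z ^+ k).
  move=> ke; rewrite -prodE; apply: pos (subE _ _) _.
  by rewrite size_cat !size_nseq subnK.
split=> k hk; first by rewrite /c chom1 posk.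
rewrite /c !chom1.
have := hyp (nseq (e - k.+2) y ++ nseq k z) (subE _ _).
rewrite size_cat !size_nseq -addnS -addnS subnK // => /(_ erefl) H.
have := H (fun i => (i == 0)%:R) (fun i => (i == 1)%:R).
rewrite /= !lincomb_cons /lincomb !big_ord0 /= rmorph0 rmorph1 prodE !mul1r !mul0r !addr0 !add0r.
have -> : y * y * (y ^+ (e - k.+2) * z ^+ k) = y ^+ (e - k) * z ^+ k.
  by rewrite (_ : e - k = (e - k.+2).+2)%N; [rewrite !exprS; ring|lia].
have -> : z * z * (y ^+ (e - k.+2) * z ^+ k) = y ^+ (e - k.+2) * z ^+ k.+2.
  by rewrite !exprS; ring.
have -> : y * z * (y ^+ (e - k.+2) * z ^+ k) = y ^+ (e - k.+1) * z ^+ k.+1.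
  by rewrite (_ : e - k.+1 = (e - k.+2).+1)%N; [rewrite !exprS; ring|lia].
by apply; exact: posk.
Qed.

(** * Lorentzian signature *)

Lemma char_poly_similar (F : fieldType) n (P A : 'M[F]_n) : P \in unitmx ->
  char_poly (invmx P *m A *m P) = char_poly A.
Proof.
move=> Pu; rewrite /char_poly /char_poly_mx !map_mxM.
set Q := map_mx polyC P; set Qi := map_mx polyC (invmx P).
have QiQ : Qi *m Q = 1%:M by rewrite -map_mxM mulVmx // map_mx1.
have -> : 'X%:M - Qi *m map_mx polyC A *m Q = Qi *m ('X%:M - map_mx polyC A) *m Q.
  by rewrite mulmxBr mulmxBl scalar_mxC -(mulmxA 'X%:M) QiQ mulmx1.
by rewrite !det_mulmx mulrAC -det_mulmx QiQ det1 mul1r.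
Qed.

Section Signature.
Local Open Scope complex_scope.
Local Open Scope sesquilinear_scope.

Lemma realsym_diag (R : rcfType) n (A : 'M[R]_n) : A^T = A ->
  exists (dl : 'I_n -> R) (P : 'M[R[i]]_n),
  [/\ P \is unitarymx,
      map_mx (real_complex R) A = P^t* *m diag_mx (\row_j (dl j)%:C) *m P &
      char_poly A = \prod_j ('X - (dl j)%:P)].
Proof.
move=> sA; pose AC := map_mx (real_complex R) A.
have hA : AC \is hermsymmx.
  apply: realsym_hermsym.
    by apply/is_hermitianmxP/matrixP => i j; rewrite expr0 scale1r !mxE -[in LHS]sA mxE.
  by apply/mxOverP => i j; rewrite mxE; apply/complex_realP; exists (A i j).
have Pu := spectral_unitarymx AC; have Punit := spectral_unit AC.
have /orthomx_spectralP AE := hermitian_normalmx hA.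
have /mxOverP Dre := hermitian_spectral_diag_real hA.
pose dl j := complex.Re (spectral_diag AC 0 j).
have dlE : spectral_diag AC = \row_j (dl j)%:C.
  apply/rowP => j; rewrite mxE /dl; have /complex_realP[k ->] := Dre 0 j; by [].
exists dl, (spectralmx AC); split=> //.
  by rewrite -dlE -invmx_unitary.
apply: (map_poly_inj (real_complex R)).
rewrite map_char_poly -/AC AE char_poly_similar // char_poly_trig.
  by rewrite rmorph_prod; apply: eq_bigr => j _; rewrite dlE /= map_polyXsubC !mxE eqxx.
exact: diag_mx_is_trig.
Qed.

(** Here [v] and [w] are complex coordinates of real vectors, so only the values of the form are
    real. The combination [z] vanishes at [j0], the only index where [dl] can be positive, so the
    form is at most 0 at [z]. *)
Lemma diag_hyperbolic (R : rcfType) n (dl : 'I_n -> R) (j0 : 'I_n)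
    (v w : 'I_n -> R[i]) (a b c : R) :
  (forall j, j != j0 -> dl j <= 0) ->
  \sum_j (dl j)%:C * (v j * (v j)^*) = a%:C ->
  \sum_j (dl j)%:C * (v j * (w j)^*) = b%:C ->
  \sum_j (dl j)%:C * (w j * (w j)^*) = c%:C ->
  0 < c -> a * c <= b ^+ 2.
Proof.
move=> neg aE bE cE c0.
have nn (z : R[i]) : 0 <= z * z^* by exact: mul_conjC_ge0.
have term j (z : R[i]) : j != j0 -> (dl j)%:C * (z * z^*) <= 0.
  by move=> jn; rewrite mulr_le0_ge0 ?nn // -[0]/(0%:C) lecR neg.
have w0 : w j0 != 0.
  apply/eqP => w0; have : c%:C <= 0%:C.
    rewrite -cE (bigD1 j0) //= w0 mul0r mulr0 add0r.
    by apply: sumr_le0 => j; exact: term.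
  by rewrite lecR leNgt c0.
have bE' : \sum_j (dl j)%:C * (w j * (v j)^*) = b%:C.
  have := congr1 conjc bE; rewrite conjc_real => <-; rewrite rmorph_sum.
  apply: eq_bigr => j _; rewrite !rmorphM -![GRing.RMorphism.sort _ _]/(conjc _).
  by rewrite conjc_real conjcK [w j * _]mulrC.
pose z j := w j0 * v j - v j0 * w j.
have S0 : \sum_j (dl j)%:C * (z j * (z j)^*) <= 0.
  have z0 : z j0 = 0 by rewrite /z mulrC subrr.
  rewrite (bigD1 j0) //= z0 mul0r mulr0 add0r.
  by apply: sumr_le0 => j; exact: term.
have SE : \sum_j (dl j)%:C * (z j * (z j)^*) =
    w j0 * (w j0)^* * a%:C - (w j0 * (v j0)^* + v j0 * (w j0)^*) * b%:C + v j0 * (v j0)^* * c%:C.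
  rewrite mulrDl opprD -{1}bE -bE' -aE -cE !mulr_sumr -!sumrN -!big_split /=.
  apply: eq_bigr => j _; rewrite /z rmorphB !rmorphM /=; ring.
move: S0 w0; rewrite SE; case: (w j0) => p q; case: (v j0) => r s S0 w0.
have : (p ^+ 2 + q ^+ 2) * a - 2 * (p * r + q * s) * b + (r ^+ 2 + s ^+ 2) * c <= 0.
  rewrite -lecR; apply: le_trans S0; rewrite le_eqVlt; apply/orP; left; apply/eqP.
  by rewrite /= ; simpc; congr (_ +i* _); ring.
move=> h.
have W0 : 0 < p ^+ 2 + q ^+ 2.
  rewrite lt_def addr_ge0 ?sqr_ge0 // andbT paddr_eq0 ?sqr_ge0 // !sqrf_eq0.
  by apply: contra w0 => /andP[/eqP-> /eqP->].
(* Multiplying by the squared modulus of [w j0] and by [c] makes the remainder a sum of two squares,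
   by Lagrange's identity. *)
have : (p ^+ 2 + q ^+ 2) * c *
    ((p ^+ 2 + q ^+ 2) * a - 2 * (p * r + q * s) * b + (r ^+ 2 + s ^+ 2) * c) <= 0.
  by rewrite pmulr_rle0 // mulr_gt0.
move=> h'; rewrite -subr_ge0 -(pmulr_rge0 _ (mulr_gt0 W0 W0)).
have sq1 := sqr_ge0 ((p ^+ 2 + q ^+ 2) * b - (p * r + q * s) * c).
have sq2 := sqr_ge0 ((p * s - q * r) * c).
rewrite -oppr_le0; apply: le_trans h'; rewrite -subr_ge0.
rewrite (_ : _ - _ = ((p ^+ 2 + q ^+ 2) * b - (p * r + q * s) * c) ^+ 2 +
  ((p * s - q * r) * c) ^+ 2); first exact: addr_ge0.
ring.
Qed.

Lemma lorentzian_signature_hyperbolic (R : realType) n (A : 'M[R]_n) (v w : 'I_n -> R) :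
  lorentzian_signature A ->
  0 < \sum_i \sum_j w i * A i j * w j ->
  (\sum_i \sum_j v i * A i j * v j) * (\sum_i \sum_j w i * A i j * w j) <=
  (\sum_i \sum_j v i * A i j * w j) ^+ 2.
Proof.
move=> [sA _ [a [a0 mupa uniqa]]].
have [dl [P [Pu AE cpE]]] := realsym_diag sA.
pose dls := [seq dl j | j <- enum 'I_n].
have cpE' : char_poly A = \prod_(x <- dls) ('X - x%:P).
  by rewrite cpE big_map big_enum.
have cnt : count_mem a dls = 1%N by rewrite -mu_prod_XsubC -cpE'.
have dlpos j : 0 < dl j -> dl j = a.
  move=> dj; apply: uniqa => //; rewrite eigenvalue_root_char cpE' root_prod_XsubC.
  by apply: map_f; rewrite mem_enum.
have [j0 j0E] : exists j0, dl j0 = a.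
  have : a \in dls by rewrite -has_pred1 has_count cnt.
  by move=> /mapP[j0 _ ->]; exists j0.
(* The root [a] is simple, so a second index with value [a] would contradict the count. *)
have neg j : j != j0 -> dl j <= 0.
  move=> jn; rewrite leNgt; apply/negP => /dlpos djE.
  move: cnt; rewrite count_map -size_filter => /eqP.
  have sub : {subset [:: j; j0] <= [seq x <- enum 'I_n | preim dl (pred1 a) x]}.
    by move=> x; rewrite !inE mem_filter mem_enum => /orP[]/eqP -> /=; rewrite ?djE ?j0E eqxx.
  have := uniq_leq_size _ sub; rewrite /= inE jn => /(_ isT).
  by move=> + /eqP szE; rewrite szE.
pose co (x : 'I_n -> R) (j : 'I_n) : R[i] := ((\row_i (x i)%:C) *m P^t*) 0 j.
have formE x y : \sum_j (dl j)%:C * (co x j * (co y j)^*) =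
    (\sum_i \sum_j x i * A i j * y j)%:C.
  have -> : (\sum_i \sum_j x i * A i j * y j)%:C =
     ((\row_i (x i)%:C) *m map_mx (real_complex R) A *m (\row_i (y i)%:C)^t*) 0 0.
    rewrite mxE exchange_big /= rmorph_sum; apply: eq_bigr => j _.
    rewrite !mxE mulr_suml rmorph_sum; apply: eq_bigr => i _.
    by rewrite !mxE !rmorphM; congr (_ * _); rewrite -[RHS]/(conjc (y j)%:C) conjc_real.
  set X := \row_i (x i)%:C; set Y := \row_i (y i)%:C.
  have -> : X *m map_mx (real_complex R) A *m Y^t* =
      X *m P^t* *m diag_mx (\row_j (dl j)%:C) *m (Y *m P^t*)^t*.
    by rewrite AE trmx_mul map_mxM trmxCK !mulmxA.
  rewrite mxE; apply: eq_bigr => j _; rewrite mul_mx_diag /co -/X -/Y.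
  by move: (X *m P^t*) (Y *m P^t*) => U U'; rewrite !mxE mulrA [_%:C * _]mulrC.
move=> w0; apply: (diag_hyperbolic neg (formE v v) (formE v w) (formE w w) w0).
Qed.

End Signature.

(** * Denormalized coefficients *)

Section Denormalization.
Variables (R : realType) (n : nat).
Implicit Types (q : {mpoly R[n]}) (m : 'X_{1..n}).

Definition mfact m : R := (\prod_(i < n) (m i)`!)%:R.
(** For [m] of the full degree of a form, this is the mixed derivative of order [m]; for
    [normalization p] it is the coefficient of [p]. *)
Definition denorm q m : R := q@_m * mfact m.
Definition word_mnm (s : seq 'I_n) : 'X_{1..n} := (\sum_(i <- s) U_(i))%MM.

Lemma mfact_gt0 m : 0 < mfact m.
Proof. by rewrite ltr0n prodn_gt0 // => i; rewrite fact_gt0. Qed.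

Lemma mfact0 : mfact 0%MM = 1.
Proof. by rewrite /mfact big1 // => i _; rewrite mnm0E. Qed.

Lemma mfactS m i : mfact (m + U_(i))%MM = mfact m * (m i).+1%:R.
Proof.
rewrite /mfact -natrM; congr _%:R.
rewrite (bigD1 i) //= [in RHS](bigD1 i) //= mnmDE mnm1E eqxx addn1 factS.
rewrite -mulnA mulnC; congr (_ * _ * _)%N; apply: eq_bigr => j ji.
by rewrite mnmDE mnm1E eq_sym (negPf ji) addn0.
Qed.

Lemma denorm_deriv q i m : denorm q^`M(i) m = denorm q (m + U_(i))%MM.
Proof. by rewrite /denorm mcoeff_deriv mfactS -mulr_natr; ring. Qed.

Lemma denorm_iter_partial q s m :
  denorm (iter_partial s q) m = denorm q (m + word_mnm s)%MM.
Proof.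
elim: s m => [|i s IH] m; first by rewrite /word_mnm big_nil addm0.
by rewrite /= denorm_deriv IH /word_mnm big_cons addmA.
Qed.

Lemma mdeg_word s : mdeg (word_mnm s) = size s.
Proof.
elim: s => [|i s IH]; first by rewrite /word_mnm big_nil mdeg0.
by rewrite /word_mnm big_cons mdegD mdeg1 IH.
Qed.

Lemma word_exists m : exists s, word_mnm s = m.
Proof.
have [k mk] := ubnP (mdeg m); elim: k m mk => // k IH m mk.
case: (eqVneq m 0%MM) => [->|m0]; first by exists [::]; rewrite /word_mnm big_nil.
have /existsP[i mi] : [exists i, m i != 0%N].
  apply: contraNT m0; rewrite negb_exists => /forallP h; apply/eqP/mnmP => i.
  by rewrite mnm0E; apply/eqP; have := h i; rewrite negbK.
have mE : m = (U_(i) + (m - U_(i)))%MM.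
  apply/mnmP => j; rewrite mnmDE mnmBE mnm1E; case: eqP => [<-|_] /=; lia.
have [|s sE] := IH (m - U_(i))%MM; first by move: mk; rewrite {1}mE mdegD mdeg1; lia.
by exists (i :: s); rewrite /word_mnm big_cons -/(word_mnm s) sE -mE.
Qed.

Lemma meval_iter_partial d q s x : q \is d.-homog -> size s = d ->
  (iter_partial s q).@[x] = denorm q (word_mnm s).
Proof.
move=> hq sz; set r := iter_partial s q.
have r0 m : m != 0%MM -> r@_m = 0.
  move=> m0; have f0 : mfact m != 0 by rewrite gt_eqF ?mfact_gt0.
  apply: (mulIf f0).
  rewrite mul0r -/(denorm r m) denorm_iter_partial /denorm.
  suff -> : q@_(m + word_mnm s) = 0 by rewrite mul0r.
  apply: (dhomog_nemf_coeff hq); rewrite -[X in X != _]/(mdeg (m + word_mnm s)).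
  by rewrite mdegD mdeg_word sz; rewrite -mdeg_eq0 in m0; lia.
have -> : r = (r@_0)%:MP.
  apply/mpolyP => m; rewrite mcoeffC; case: (eqVneq m 0%MM) => [->|/r0 ->].
    by rewrite mulr1.
  by rewrite mulr0.
rewrite mevalC; have := denorm_iter_partial q s 0%MM.
by rewrite add0m => <-; rewrite /denorm mfact0 mulr1.
Qed.

(** After [d - 2] derivatives the Hessian is constant, with denormalized coefficients as entries,
    and it is read at the point [1]. *)
Lemma strictly_lorentzian_hyperbolic d q m (v w : 'I_n -> R) :
  strictly_lorentzian d q -> (mdeg m).+2 = d ->
  let B (v w : 'I_n -> R) :=
    \sum_i \sum_j v i * w j * denorm q (U_(i) + U_(j) + m)%MM in
  0 < B w w -> B v v * B w w <= B v w ^+ 2.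
Proof.
move=> [_ hq _ hess] md B.
have [s sE] := word_exists m.
have sz : size s == (d - 2)%N by rewrite -mdeg_word sE -md; lia.
have := hess (Tuple sz) (fun=> 1) (fun=> ltr01) => /lorentzian_signature_hyperbolic H.
have BE x y : B x y = \sum_i \sum_j x i * hessian (iter_partial (Tuple sz) q) (fun=> 1) i j * y j.
  apply: eq_bigr => i _; apply: eq_bigr => j _; rewrite mxE.
  have := @meval_iter_partial d q [:: i, j & s] (fun=> 1) hq; rewrite /= => ->.
    by rewrite /word_mnm !big_cons -/(word_mnm s) sE addmA; ring.
  by rewrite -mdeg_word sE md.
by rewrite !BE; exact: H.
Qed.

End Denormalization.

(** * Functionals attached to strictly Lorentzian polynomials *)

Section LorentzianFunctional.
Variables (R : realType) (n : nat).
Implicit Types (q : {mpoly R[n]}) (m b : 'X_{1..n}) (P : 'X_{1..n} -> R).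

Definition mpolyC_rmorph : {rmorphism R -> {mpoly R[n]}} := @mpolyC n R.
Notation iota := mpolyC_rmorph.

(** The linear form sending the monomial [m] to [P m], cut off above degree [d] to be a finite
    sum. *)
Definition mpairing d P q : R := \sum_(m : 'X_{1..n < d.+1}) q@_m * P m.

Lemma mpairing_functional d P b : functional iota (fun q => mpairing d P (q * 'X_[b])).
Proof.
split=> [q r|r q]; rewrite /mpairing.
  by rewrite -big_split; apply: eq_bigr => m _ /=; rewrite mulrDl mcoeffD mulrDl.
by rewrite mulr_sumr; apply: eq_bigr => m _; rewrite -mulrA mcoeffCM mulrA.
Qed.

Lemma mpairingX d P m : (mdeg m <= d)%N -> mpairing d P 'X_[m] = P m.
Proof.
move=> md; have md' : (mdeg m < d.+1)%N by [].
rewrite /mpairing (bigD1 (BMultinom md')) //= mcoeffX eqxx mul1r big1 ?addr0 // => k.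
by rewrite -val_eqE /= mcoeffX eq_sym => /negPf ->; rewrite mul0r.
Qed.

Variable x : 'I_n -> R.
Hypothesis x_gt0 : forall l, 0 < x l.
Let letter l : {mpoly R[n]} := (x l)%:MP * 'X_l.

Lemma letter_word (ls : seq 'I_n) s : {subset s <= map letter ls} ->
  exists A m, [/\ 0 < A, mdeg m = size s & \prod_(a <- s) a = A%:MP * 'X_[m]].
Proof.
elim: s => [|a s IH] sL.
  by exists 1, 0%MM; rewrite big_nil mdeg0 mpolyX0 mulr1 mpolyC1; split; rewrite ?ltr01.
have [|A [m [A0 md E]]] := IH; first by move=> y ys; apply: sL; rewrite inE ys orbT.
have /mapP[l _ aE] := sL a (mem_head _ _).
exists (x l * A), (U_(l) + m)%MM; rewrite big_cons E aE mdegD mdeg1 md; split => //.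
  by rewrite mulr_gt0.
by rewrite /letter mpolyCM mpolyXD; ring.
Qed.

Lemma letter_lincomb (ls : seq 'I_n) c :
  exists v : 'I_n -> R, lincomb iota c (map letter ls) = \sum_l (v l)%:MP * 'X_l.
Proof.
elim: ls c => [|l ls IH] c.
  exists (fun=> 0); rewrite /lincomb big_ord0 big1 // => l _.
  by rewrite mpolyC0 mul0r.
rewrite /= lincomb_cons; have [v ->] := IH (fun i => c i.+1).
exists (fun k => (k == l)%:R * (c 0 * x l) + v k).
rewrite [RHS](eq_bigr (fun k => ((k == l)%:R * (c 0 * x l))%:MP * 'X_k + (v k)%:MP * 'X_k)); last first.
  by move=> k _; rewrite mpolyCD mulrDl.
rewrite big_split /=; congr (_ + _).
rewrite (bigD1 l) //= eqxx mul1r big1 ?addr0; first by rewrite /letter mpolyCM mulrA.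
by move=> k /negPf ->; rewrite mul0r mpolyC0 mul0r.
Qed.

Lemma mpairing_quadratic d P (v w : 'I_n -> R) A m b : (mdeg m + mdeg b).+2 = d ->
  mpairing d P ((\sum_l (v l)%:MP * 'X_l) * (\sum_l (w l)%:MP * 'X_l) * (A%:MP * 'X_[m]) * 'X_[b])
  = A * \sum_i \sum_j v i * w j * P (U_(i) + U_(j) + (m + b))%MM.
Proof.
move=> md; have h := mpairing_functional d P 0%MM.
have E q : mpairing d P q = mpairing d P (q * 'X_[0%MM]) by rewrite mpolyX0 mulr1.
rewrite E; set q := _ * 'X_[b].
have -> : q = \sum_i \sum_j iota (A * (v i * w j)) * 'X_[U_(i) + U_(j) + (m + b)].
  rewrite /q -mulrA mulr_suml mulr_suml; apply: eq_bigr => i _.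
  rewrite mulr_sumr mulr_suml; apply: eq_bigr => j _.
  by rewrite /= !mpolyCM !mpolyXD; ring.
rewrite (functional_sum _ _ _ h) mulr_sumr; apply: eq_bigr => i _.
rewrite (functional_sum _ _ _ h) mulr_sumr; apply: eq_bigr => j _.
by rewrite h.2 -E mpairingX ?mulrA // !mdegD !mdeg1 -md.
Qed.

(** The factor ['X_[b]] accounts for the variables already extracted; the letters are variables
    scaled by [x]. *)
Lemma strictly_lorentzian_functional d e u b (ls : seq 'I_n) :
  strictly_lorentzian d u -> (mdeg b + e)%N = d ->
  lorentzian_functional iota e
    (fun q => mpairing d (denorm u) (q * 'X_[b])) (map letter ls).
Proof.
move=> slu bd; have [_ _ upos _] := slu; split; first exact: mpairing_functional.
- move=> s sL sz; have [A [m [A0 md ->]]] := letter_word sL.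
  have [_ h] := mpairing_functional d (denorm u) b.
  rewrite (h A) mulr_gt0 // -mpolyXD mpairingX; last by rewrite mdegD md sz addnC bd.
  by rewrite mulr_gt0 ?mfact_gt0 // upos // mdegD md sz addnC.
move=> s sL sz c1 c2.
have [v ->] := letter_lincomb ls c1; have [w ->] := letter_lincomb ls c2.
have [A [m [A0 md ->]]] := letter_word sL.
have mbd : (mdeg m + mdeg b).+2 = d by rewrite md -bd -sz !addnS addnC.
rewrite /= !mpairing_quadratic // pmulr_rgt0 // => w0.
have mbd' : (mdeg (m + b)).+2 = d by rewrite mdegD.
have := strictly_lorentzian_hyperbolic v slu mbd' w0.
rewrite mulrACA exprMn -expr2 => H; apply: ler_wpM2l H.
exact: sqr_ge0.
Qed.

End LorentzianFunctional.

(** * Coefficients of complete homogeneous polynomials in the letters *)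

Lemma mcoeffMXE (R : comNzRingType) n (q : {mpoly R[n]}) g m :
  (q * 'X_[g])@_m = if (g <= m)%MM then q@_(m - g) else 0.
Proof.
case: ifP => gm; first by rewrite -{1}(submK gm) addmC mcoeffMX.
apply/eqP; rewrite mcoeff_eq0 (perm_mem (msuppMX _ _)); apply/negP => /mapP[k _ mE].
by move: gm; rewrite mE lem_addr.
Qed.

Section ChomCoeff.
Variables (R : comNzRingType) (n : nat) (x : 'I_n -> R).

(** Each monomial in the variables of [ls] occurs exactly once, so pairing with [chom] amounts to
    evaluation at [x]. *)
Lemma mcoeff_chom (ls : seq 'I_n) k m : uniq ls ->
  (chom (map (fun l => (x l)%:MP * 'X_l) ls) k)@_m =
  ((mdeg m == k) && [forall l, (l \in ls) || (m l == 0%N)])%:R * \prod_(l <- ls) x l ^+ m l.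
Proof.
elim: ls k m => [|l ls IH] k m.
  move=> _; rewrite /= big_nil mulr1 -mpolyC_nat mcoeffC -natrM mulnb; congr (nat_of_bool _)%:R.
  have -> : [forall l, (l \in [::]) || (m l == 0%N)] = (m == 0%MM).
    apply/forallP/eqP => [h|-> l]; last by rewrite mnm0E.
    by apply/mnmP => l; rewrite mnm0E; apply/eqP/h.
  by case: (eqVneq m 0%MM) => [->|_]; rewrite ?andbF // mdeg0 eq_sym.
rewrite cons_uniq => /andP[lls uls]; rewrite big_cons map_cons.
elim: k m => [|k IHk] m.
  rewrite chom0 mcoeff1 mdeg_eq0; case: (eqVneq m 0%MM) => [->|_]; last by rewrite mul0r.
  rewrite mnm0E expr0 mul1r big1 ?mulr1; last by move=> i _; rewrite mnm0E expr0.
  by have -> : [forall i, (i \in l :: ls) || (@mnm0 n i == 0%N)] by apply/forallP => i; rewrite mnm0E orbT.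
rewrite chomS mcoeffD IH // -mulrA mcoeffCM mulrC.
rewrite ['X_l * _]mulrC mcoeffMXE.
case: (posnP (m l)) => ml.
  have -> : (U_(l) <= m)%MM = false.
    by apply/negP => /mnm_lepP/(_ l); rewrite mnm1E eqxx ml.
  rewrite mulr0 addr0 ml expr0 mul1r mulrC; congr ((nat_of_bool (_ && _))%:R * _).
  apply: eq_forallb => i; rewrite inE; case: (eqVneq i l) => [->|//].
  by rewrite ml eqxx orbT.
have lm : (U_(l) <= m)%MM.
  by apply/mnm_lepP => i; rewrite mnm1E; case: eqP => [<-|].
have -> : [forall i, (i \in ls) || (m i == 0%N)] = false.
  by apply/negP => /forallP/(_ l); rewrite (negPf lls) eqn0Ngt ml.
rewrite andbF mulr0 add0r lm IHk.
have mE := submK lm; set m' := (m - U_(l))%MM in mE *.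
have mi i : m i = (m' i + (l == i))%N by rewrite -mE mnmDE mnm1E.
have -> : (mdeg m == k.+1) = (mdeg m' == k) by rewrite -mE mdegD mdeg1 addn1.
have -> : [forall i, (i \in l :: ls) || (m i == 0%N)] = [forall i, (i \in l :: ls) || (m' i == 0%N)].
  apply: eq_forallb => i; rewrite inE mi eq_sym; case: (l == i) => //=.
  by rewrite addn0.
rewrite (mi l) eqxx addn1 exprS.
have -> : \prod_(j <- ls) x j ^+ m j = \prod_(j <- ls) x j ^+ m' j.
  rewrite big_seq [RHS]big_seq; apply: eq_bigr => j jls; rewrite mi.
  by case: eqP => [lj|]; rewrite ?addn0 //; move: lls; rewrite lj jls.
by ring.
Qed.
End ChomCoeff.

(** * Slices of coefficients *)

Section Slice.
Variables (R : realType) (n d : nat) (alpha : 'X_{1..n}) (i : 'I_n).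
Implicit Types (P : 'X_{1..n} -> R) (x : 'I_n -> R) (m : 'X_{1..n}).

Definition upper_part : 'X_{1..n} := [multinom (if (i < l)%N then alpha l else 0%N) | l < n].
Definition in_slice k m : bool :=
  [&& mdeg m == d, m i == k & [forall l : 'I_n, (i < l)%N ==> (m l == alpha l)]].
(** The coefficient of the [k]-th power of variable [i] once the variables below [i] are set to [x]
    and those above are extracted at [alpha]. *)
Definition slice P x k : R :=
  \sum_(m : 'X_{1..n < d.+1} | in_slice k m) P m * \prod_(l < n | (l < i)%N) x l ^+ m l.

Let lower := [seq l : 'I_n <- enum 'I_n | (l < i)%N].
Let gam k : 'X_{1..n} := (U_(i) *+ k + upper_part)%MM.

Let gamE k l : gam k l = (if l == i then k else if (i < l)%N then alpha l else 0)%N.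
Proof.
rewrite /gam mnmDE mulmnE mnm1E mnmE eq_sym; case: eqP => [->|_].
  by rewrite ltnn mul1n addn0.
by rewrite mul0n.
Qed.

Let mdeg_gam k : mdeg (gam k) = (k + mdeg upper_part)%N.
Proof. by rewrite mdegD mdegMn mdeg1 mul1n. Qed.

Let in_slice_gam k m : in_slice k m = [&& mdeg m == d, (gam k <= m)%MM &
  [forall l, (l \in lower) || ((m - gam k)%MM l == 0%N)]].
Proof.
have lowE l : (l \in lower) = (l < i)%N by rewrite mem_filter mem_enum andbT.
have ne (l : 'I_n) : (i < l)%N -> (l == i) = false by rewrite -val_eqE => /gtn_eqF.
rewrite /in_slice; congr (_ && _); apply/andP/andP => -[].
  move=> /eqP mi /forallP h; split.
    apply/mnm_lepP => l; rewrite gamE; case: eqP => [->|_]; first by rewrite mi.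
    by case: ifP => // il; have := h l; rewrite il => /eqP ->.
  apply/forallP => l; rewrite lowE mnmBE gamE.
  case: (ltngtP l i) => //= [il|/val_inj ->]; last by rewrite eqxx mi subnn.
  have /eqP -> : m l == alpha l by have := h l; rewrite il.
  by rewrite ne // subnn.
move=> /mnm_lepP le /forallP h.
have ge (l : 'I_n) : (i <= l)%N -> m l = gam k l.
  move=> il; have := h l; rewrite lowE ltnNge il /= mnmBE subn_eq0 => le'.
  by apply/eqP; rewrite eqn_leq le' le.
split; first by rewrite ge // gamE eqxx.
apply/forallP => l; apply/implyP => il; rewrite ge ?(ltnW il) // gamE il.
by rewrite ne.
Qed.

Lemma in_slice_deg k m : in_slice k m -> (k + mdeg upper_part <= d)%N.
Proof.
rewrite in_slice_gam => /and3P[/eqP <- /submK <- _].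
by rewrite mdegD mdeg_gam leq_addl.
Qed.

Lemma slice_eq0 P x k : (d < k + mdeg upper_part)%N -> slice P x k = 0.
Proof.
move=> kd; rewrite /slice big_pred0 // => m; apply/negP => /in_slice_deg.
by rewrite leqNgt kd.
Qed.

Lemma slice_chom P x e k : (mdeg upper_part + e)%N = d -> (k <= e)%N ->
  mpairing d P (chom [seq (x l)%:MP * 'X_l | l <- lower] (e - k) * 'X_i ^+ k
                * 'X_[upper_part]) = slice P x k.
Proof.
move=> ed ke; rewrite /slice big_mkcond; apply: eq_bigr => m _.
rewrite -mulrA mpolyXn -mpolyXD -/(gam k) mcoeffMXE in_slice_gam.
case: ifP => [le|_]; last by rewrite andbF mul0r.
rewrite mcoeff_chom; last exact/filter_uniq/enum_uniq.
have -> : (mdeg (m - gam k)%MM == (e - k)%N) = (mdeg m == d).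
  have := mdegD (m - gam k)%MM (gam k); rewrite submK // mdeg_gam => ->.
  by apply/eqP/eqP; lia.
rewrite [true && _]/=; case: (_ && _); last by rewrite !mul0r.
rewrite mul1r mulrC; congr (_ * _); rewrite big_filter big_enum_cond /=.
apply: eq_bigr => l li; rewrite mnmBE gamE -val_eqE ltn_eqF //= ltnNge.
by rewrite (ltnW li) /= subn0.
Qed.

Lemma strictly_lorentzian_slice u x e :
  strictly_lorentzian d u -> (0 < i)%N -> (forall l, 0 < x l) ->
  (mdeg upper_part + e)%N = d ->
  (forall k, (k <= e)%N -> 0 < slice (denorm u) x k) /\
  (forall k, (k.+2 <= e)%N -> slice (denorm u) x k * slice (denorm u) x k.+2 <=
                              slice (denorm u) x k.+1 ^+ 2).
Proof.
move=> slu i0 x0 ed.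
(* The last letter must be ['X_i] itself, hence the value 1 at [i]; the slice only involves [x]
   below [i]. *)
pose x' l := if l == i then 1 else x l.
have x'0 l : 0 < x' l by rewrite /x'; case: ifP.
have lowE l : (l \in lower) = (l < i)%N by rewrite mem_filter mem_enum andbT.
have lowx : [seq (x' l)%:MP * 'X_l | l <- lower] = [seq (x l)%:MP * 'X_l | l <- lower].
  by apply/eq_in_map => l; rewrite lowE /x' -val_eqE => /ltn_eqF ->.
have := strictly_lorentzian_functional x'0 (rcons lower i) slu ed.
have xi : (x' i)%:MP * 'X_i = 'X_i by rewrite /x' eqxx mpolyC1 mul1r.
rewrite map_rcons lowx xi.
(* As [i] is not the first variable, some letter below it can play the role of [y]. *)
have : Ordinal (ltn_trans i0 (ltn_ord i)) \in lower by rewrite lowE.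
have := slice_chom (denorm u) x ed.
case: lower => [//|l0 ls] sE _ /lorentzian_log_concave[pos lc]; split=> k ke.
  by rewrite -sE //; exact: pos.
by rewrite -!sE; [exact: lc|lia..].
Qed.

End Slice.

(** This form of log-concavity excludes internal zeros as well and, being a closed condition,
    survives limits. *)
Lemma log_concave_cross (R : realFieldType) (c : nat -> R) e :
  (forall k, (k <= e)%N -> 0 < c k) -> (forall k, (e < k)%N -> c k = 0) ->
  (forall k, (k.+2 <= e)%N -> c k * c k.+2 <= c k.+1 ^+ 2) ->
  forall a b, (a < b)%N -> c a * c b <= c a.+1 * c b.-1.
Proof.
move=> pos zero lc a b ab; rewrite -(subnK ab) addnC; set t := (b - a.+1)%N.
have c0 k : 0 <= c k by case: (leqP k e) => [/pos/ltW //|/zero ->].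
rewrite addSn /=; case: (leqP (a + t).+1 e) => [|/zero ->]; last by rewrite mulr0 mulr_ge0.
elim: t => [|t IH] te; first by rewrite addn0 mulrC.
have := IH; rewrite addnS in te *; move=> /(_ (ltnW te)) H.
have cat : 0 < c (a + t)%N by apply: pos; lia.
rewrite -(ler_pM2r cat).
apply: (@le_trans _ _ (c a * c (a + t).+1 ^+ 2)).
  by rewrite -mulrA [c (a + t).+2 * _]mulrC; apply: ler_wpM2l => //; apply: lc.
by rewrite expr2 mulrA [leRHS]mulrAC; apply: ler_wpM2r.
Qed.

Lemma mcoeff_normalization (R : realType) n (p : {mpoly R[n]}) m :
  (normalization p)@_m = p@_m / mfact R m.
Proof.
rewrite /normalization raddf_sum /=.
under eq_bigr do rewrite mcoeffZ mcoeffX.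
case: (boolP (m \in msupp p)) => [mp|].
  rewrite (bigD1_seq m) ?msupp_uniq //= eqxx mulr1 [X in _ + X]big1 ?addr0 // => k /negPf ->.
  by rewrite mulr0.
move=> mp; rewrite memN_msupp_eq0 // mul0r big_seq big1 // => k kp.
by case: eqP => [km|_]; rewrite ?mulr0 //; move: mp; rewrite -km kp.
Qed.

Lemma denorm_normalization (R : realType) n (p : {mpoly R[n]}) m :
  denorm (normalization p) m = p@_m.
Proof. by rewrite /denorm mcoeff_normalization divfK // gt_eqF ?mfact_gt0. Qed.

Section SliceLimit.
Local Open Scope classical_set_scope.

Lemma slice_ge0 (R : realType) n d (p : {mpoly R[n]}) alpha (i : 'I_n) (x : 'I_n -> R) k :
  nonneg_coeffs p -> (forall l, 0 < x l) -> 0 <= slice d alpha i (fun m => p@_m) x k.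
Proof.
move=> pnn x0; apply: sumr_ge0 => m _; apply: mulr_ge0; first exact: pnn.
by apply: prodr_ge0 => l _; rewrite exprn_ge0 ?ltW.
Qed.

(** The strictly Lorentzian approximants satisfy the inequality, and slices depend continuously on
    the coefficients. *)
Lemma denormalized_slice_cross (R : realType) n d (p : {mpoly R[n]}) alpha (i : 'I_n) (x : 'I_n -> R) :
  denormalized_lorentzian d p -> (0 < i)%N -> (forall l, 0 < x l) ->
  (mdeg (upper_part alpha i) <= d)%N ->
  forall a b, (a < b)%N ->
    let c := slice d alpha i (fun m => p@_m) x in c a * c b <= c a.+1 * c b.-1.
Proof.
move=> [hom pnn]; rewrite /lorentzian; case: (boolP (d < 2)%N) => [d2 _|_ [u [su cu]]] i0 x0 bd a b ab;
  set c := slice d alpha i _ x.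
  have c0 k : 0 <= c k by exact: slice_ge0.
  (* In degree below 2 the only nontrivial case is [a = 0], [b = 1], an equality. *)
  have [b2|b2] := leqP 2 b.
    have -> : c b = 0 by apply: slice_eq0; lia.
    by rewrite mulr0 mulr_ge0.
  have [-> ->] : a = 0%N /\ b = 1%N by lia.
  by rewrite mulrC.
have cvgs k : slice d alpha i (denorm (u t)) x k @[t --> \oo] --> c k.
  rewrite /c /slice; apply: cvg_big => [|m _]; first exact: add_continuous.
  apply: cvgMr_tmp; rewrite -(denorm_normalization p m); apply: cvgMr_tmp; exact: cu.
apply: (ler_cvg_to (cvgM (cvgs a) (cvgs b)) (cvgM (cvgs a.+1) (cvgs b.-1))).
near=> t.
have ed : (mdeg (upper_part alpha i) + (d - mdeg (upper_part alpha i)))%N = d by lia.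
have [pos lc] := strictly_lorentzian_slice (su t) i0 x0 ed.
apply: (log_concave_cross pos _ lc ab) => k ke; apply: slice_eq0; lia.
Unshelve. all: by end_near.
Qed.

End SliceLimit.

(** * Capacity of the geometric form *)

Section GeometricCapacity.
Variable R : realType.
Implicit Types (t K L : R).

(** The quotient in the capacity of the geometric form, written in the single variable
    [t = y / x]. *)
Definition geosum D m t : R := (\sum_(k < D.+1) t ^+ k) / t ^+ m.
Definition geocap (D m : nat) : R :=
  bicapacity (D%:R - m%:R) m%:R (geometric_form R D).

Lemma geometric_value D m (y : 'I_2 -> R) : (forall i, 0 < y i) ->
  (geometric_form R D).@[y] /
    \prod_(i < 2) y i `^ tnth [tuple D%:R - m%:R; m%:R] i = geosum D m (y 1 / y 0).
Proof.
move=> y0.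
have [a0 b0] : y 0 != 0 /\ y 1 != 0 by rewrite !gt_eqF.
have -> : \prod_(i < 2) y i `^ tnth [tuple D%:R - m%:R; m%:R] i =
    y 0 ^+ D / y 0 ^+ m * y 1 ^+ m.
  rewrite big_ord_recl big_ord1 !(tnth_nth 0) /= powRB ?a0 ?implybT // !powR_mulrn ?ltW //.
  by have -> : lift ord0 ord0 = 1 :> 'I_2 by apply/val_inj.
rewrite /geometric_form raddf_sum /=.
rewrite /geosum [in RHS](reindex_inj rev_ord_inj) /= mulr_suml [RHS]mulr_suml.
apply: eq_bigr => k _.
have kD : (k <= D)%N by rewrite -ltnS.
rewrite subSS rmorphM /= !rmorphXn /= !mevalXU !expr_div_n; move: (y 0) (y 1) a0 b0 => a b a0 b0.
have -> : a ^+ D = a ^+ k * a ^+ (D - k) by rewrite -exprD subnKC.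
by field; rewrite !expf_neq0.
Qed.

Lemma geocap_le D m t : 0 < t -> geocap D m <= geosum D m t.
Proof.
move=> t0.
pose y (i : 'I_2) : R := if i == 0 then 1 else t.
have y0 i : 0 < y i by rewrite /y; case: ifP.
apply: ge_inf.
  exists 0 => _ /= [z z0 <-]; rewrite geometric_value //.
  apply: divr_ge0; last by rewrite exprn_ge0 ?divr_ge0 ?ltW.
  by apply: sumr_ge0 => k _; rewrite exprn_ge0 ?divr_ge0 ?ltW.
by exists y => //=; rewrite geometric_value // /y /= divr1.
Qed.

Lemma le_geocap D m L : (forall t, 0 < t -> L <= geosum D m t) -> L <= geocap D m.
Proof.
move=> h; apply: lb_le_inf.
  by exists ((geometric_form R D).@[fun=> 1] / \prod_(i < 2) 1 `^ tnth [tuple D%:R - m%:R; m%:R] i), (fun=> 1) => //= _.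
move=> _ /= [z z0 <-]; rewrite geometric_value //; apply: h.
by rewrite divr_gt0.
Qed.

Lemma geosum_ge0 D m t : 0 < t -> 0 <= geosum D m t.
Proof.
move=> t0; apply: divr_ge0; last by rewrite exprn_ge0 ?ltW.
by apply: sumr_ge0 => k _; rewrite exprn_ge0 ?ltW.
Qed.

Lemma geocap_ge0 D m : 0 <= geocap D m.
Proof. by apply: le_geocap => t; exact: geosum_ge0. Qed.

Lemma geosum_inv D m t : 0 < t -> (m <= D)%N -> geosum D m t^-1 = geosum D (D - m) t.
Proof.
move=> t0 mD; have tn : t != 0 by rewrite gt_eqF.
rewrite /geosum (reindex_inj rev_ord_inj) /= !mulr_suml; apply: eq_bigr => k _.
have kD : (k <= D)%N by rewrite -ltnS.
rewrite subSS !exprVn invrK.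
rewrite mulrC; apply/eqP; rewrite eqr_div ?expf_neq0 // -!exprD.
by apply/eqP; congr (_ ^+ _); lia.
Qed.

Lemma le0_of_small L S : 0 <= S -> (forall s, 0 < s -> s <= 1 -> L <= s * S) -> L <= 0.
Proof.
move=> S0 h; rewrite leNgt; apply/negP => L0.
have S1 : 0 < 2 * (S + 1) by lra.
pose s := Num.min 1 (L / (2 * (S + 1))).
have s0 : 0 < s by rewrite lt_min ltr01 divr_gt0.
have := h s s0; rewrite ge_min lexx => /(_ isT).
have : s * (2 * (S + 1)) <= L by rewrite -ler_pdivlMr // ge_min lexx orbT.
by nra.
Qed.

(** The geometric series times [1 - t] is at most 1, hence [(1 - t) * (K * t ^+ j) <= 1] for
    [0 < t < 1]. The left side is largest at [t = j / (j + 1)], which produces [pow_ratio]. *)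
Lemma geosum_pow_ratio D j K : 0 <= K -> (forall t, 0 < t -> K <= geosum D j t) ->
  pow_ratio R j%:Z * K <= 1.
Proof.
move=> K0 h.
have geo t : 0 < t -> t < 1 -> (1 - t) * (K * t ^+ j) <= 1.
  move=> t0 t1; have := h t t0; rewrite /geosum ler_pdivlMr ?exprn_gt0 // => Kt.
  apply: (@le_trans _ _ ((1 - t) * \sum_(k < D.+1) t ^+ k)).
    by apply: ler_wpM2l => //; rewrite subr_ge0 ltW.
  have -> : (1 - t) * \sum_(k < D.+1) t ^+ k = 1 - t ^+ D.+1.
    by rewrite -[1 - t]opprB mulNr -subrX1 opprB.
  by rewrite lerBlDr lerDl exprn_ge0 ?ltW.
rewrite /pow_ratio -[X in (j%:Z + X)]/(1%:Z) -PoszD addn1 -!exprnP -!pmulrn.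
case: j h geo => [|j] h geo.
  rewrite expr0 expr1 invr1 mulr1 mul1r.
  (* For [j = 0] the best value [t = 0] is excluded and is reached as a limit. *)
  suff : 0 <= (1%:P - K%:P * (1%:P - 'X)).[0] by rewrite !hornerE subr0 mulr1 subr_ge0.
  apply: poly_ge0_at0 => r r0.
  rewrite !hornerE; case: (ltP r 1) => r1.
    by have := geo r r0 r1; rewrite expr0 mulr1 subr_ge0 mulrC.
  by nra.
set a : R := j.+1%:R; set b : R := j.+2%:R.
have a0 : 0 < a by rewrite ltr0n.
have b0 : 0 < b by rewrite ltr0n.
have ba : b = a + 1 by rewrite /a /b -natr1.
have := geo (a / b); rewrite divr_gt0 // ltr_pdivrMr // mul1r ba ltrDl ltr01 -ba => /(_ isT isT).
have bn := lt0r_neq0 b0.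
have -> : 1 - a / b = b^-1 by rewrite (_ : a = b - 1); [field|rewrite ba addrK].
move=> H; rewrite (_ : _ * K = b^-1 * (K * (a / b) ^+ j.+1)) //.
rewrite expr_div_n [b ^+ j.+2]exprS {a0 b0 ba H}; move: a b bn => a b bn.
by field; rewrite expf_neq0 ?bn.
Qed.

Lemma geocap_pow_ratio D m : (m <= D)%N ->
  pow_ratio R m%:Z * geocap D m <= 1 /\
  pow_ratio R (D%:Z - m%:Z) * geocap D m <= 1.
Proof.
move=> mD; split; first by apply: (@geosum_pow_ratio D); [exact: geocap_ge0|exact: geocap_le].
rewrite subzn //; apply: (@geosum_pow_ratio D); first exact: geocap_ge0.
by move=> t t0; rewrite -geosum_inv //; apply: geocap_le; rewrite invr_gt0.
Qed.

Lemma expr_le_self (s : R) e : 0 < s -> s <= 1 -> (0 < e)%N -> s ^+ e <= s.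
Proof.
move=> s0 s1; case: e => // e _; rewrite exprS ler_piMr ?(ltW s0) //.
by rewrite exprn_ile1 ?(ltW s0).
Qed.

(** The quotient tends to 0 as [t] grows; it is taken at the inverse of a small [s]. *)
Lemma geocap_eq0 D m : (D < m)%N -> geocap D m = 0.
Proof.
move=> Dm; apply/eqP; rewrite eq_le geocap_ge0 andbT.
apply: (@le0_of_small _ D.+1%:R) => // s s0 s1.
apply: le_trans (geocap_le D m (_ : 0 < s^-1)) _; first by rewrite invr_gt0.
rewrite /geosum exprVn invrK mulr_suml.
have -> : s * D.+1%:R = \sum_(k < D.+1) s by rewrite sumr_const card_ord mulr_natr.
apply: ler_sum => k _; rewrite exprVn -(subnK (ltnW (leq_trans (ltn_ord k) Dm))).
rewrite exprD mulrC -mulrA divff ?expf_neq0 ?gt_eqF // mulr1.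
by apply: expr_le_self => //; have := ltn_ord k; lia.
Qed.

(* [ln r] is the slope of a line supporting the concave function [ln c] at [m]. *)
Lemma cross_geometric_bound (c : nat -> R) m : (forall k, 0 <= c k) -> 0 < c m ->
  (forall a b, (a < b)%N -> c a * c b <= c a.+1 * c b.-1) ->
  exists2 r, 0 < r & forall k, c k * r ^+ m <= c m * r ^+ k.
Proof.
move=> c0 cm cross.
have up r : 0 < r -> c m.+1 <= r * c m -> forall t : nat, c (m + t)%N <= c m * r ^+ t.
  move=> r0 cr; elim=> [|t IH]; first by rewrite addn0 expr0 mulr1.
  have := cross m (m + t).+1; rewrite ltnS leq_addr => /(_ isT) /= H.
  rewrite addnS -(ler_pM2l cm); apply: le_trans H _.
  apply: le_trans (ler_wpM2r (c0 _) cr) _.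
  rewrite -mulrA mulrCA ler_pM2l // exprS mulrCA.
  by rewrite ler_pM2l.
have down r : 0 < r -> ((0 < m)%N -> c m.-1 * r <= c m) ->
    forall t : nat, (t <= m)%N -> c (m - t)%N * r ^+ t <= c m.
  move=> r0 cr; elim=> [|t IH] tm; first by rewrite subn0 expr0 mulr1.
  have := cross (m - t.+1)%N m; rewrite ltn_subrL (leq_ltn_trans _ tm) // -subSn // subSS.
  move=> /(_ isT) H; rewrite -(ler_pM2r cm) mulrAC.
  have rt : 0 < r ^+ t.+1 by rewrite exprn_gt0.
  apply: le_trans (ler_wpM2r (ltW rt) H) _; rewrite exprSr.
  rewrite [leLHS](_ : _ = c (m - t)%N * r ^+ t * (c m.-1 * r)); last by ring.
  apply: ler_pM; rewrite ?mulr_ge0 ?exprn_ge0 ?(ltW r0) //; first exact/IH/ltnW.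
  by apply: cr; apply: leq_ltn_trans tm.
(* The ratio is taken on the right of [m] if [c m.+1] is nonzero, otherwise on the left, and it is 1
   if the left one is absent or has a zero neighbour. *)
have [r [r0 r1 r2]] : exists r, [/\ 0 < r, c m.+1 <= r * c m & (0 < m)%N -> c m.-1 * r <= c m].
  have cmn : c m != 0 by rewrite gt_eqF.
  have := c0 m.+1; rewrite le_eqVlt => /orP[/eqP cm1|cm1]; last first.
    exists (c m.+1 / c m); rewrite divr_gt0 // divfK //; split=> // m0.
    rewrite mulrA ler_pdivrMr //; have := cross m.-1 m.+1; rewrite /= prednK //; apply.
    exact: leqnSn.
  case: (posnP m) => [m0|m0]; first by exists 1; rewrite -cm1 mul1r ltW // ltr01.
  have := c0 m.-1; rewrite le_eqVlt => /orP[/eqP cp|cp].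
    by exists 1; rewrite -cm1 -cp mul1r mul0r ltW // ltr01.
  exists (c m / c m.-1); rewrite divr_gt0 // -cm1 !mulr_ge0 ?invr_ge0 //; split=> // _.
  by rewrite mulrC divfK // gt_eqF.
exists r => // k; case: (leqP m k) => [mk|km].
  rewrite -[in c k](subnKC mk) -[in r ^+ k](subnK mk) exprD mulrA.
  by apply: ler_wpM2r; [rewrite exprn_ge0 ?ltW|exact: up].
have := down r r0 r2 (m - k)%N (leq_subr _ _); rewrite (subKn (ltnW km)) => H.
rewrite -[in r ^+ m](subnK (ltnW km)) exprD mulrA.
by apply: ler_wpM2r; rewrite ?exprn_ge0 ?(ltW r0).
Qed.

(** If [c m] is positive, the bound by a geometric sequence of ratio [r], used at [t / r], reduces
    to the geometric form. If [c m] is 0, then [c] vanishes on one side of [m], and the quotient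
    becomes small as [t] tends to 0 or to infinity. *)
Lemma geocap_bound (c : nat -> R) D m L : (forall k, 0 <= c k) ->
  (forall k, (D < k)%N -> c k = 0) ->
  (forall a b, (a < b)%N -> c a * c b <= c a.+1 * c b.-1) ->
  (forall t, 0 < t -> L <= (\sum_(k < D.+1) c k * t ^+ k) / t ^+ m) ->
  L <= geocap D m * c m.
Proof.
move=> c0 cD cross hL; have := c0 m; rewrite le_eqVlt => /orP[/eqP cm|cm]; last first.
  have [r r0 hr] := cross_geometric_bound c0 cm cross.
  rewrite -ler_pdivrMr //; apply: le_geocap => t t0; rewrite ler_pdivrMr //.
  have rt : 0 < t / r by rewrite divr_gt0.
  apply: le_trans (hL _ rt) _; rewrite /geosum mulrAC !mulr_suml; apply: ler_sum => k _.
  rewrite !expr_div_n; have := hr k => H.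
  have rn : r != 0 by rewrite gt_eqF.
  have tn : t != 0 by rewrite gt_eqF.
  have -> : c k * (t ^+ k / r ^+ k) / (t ^+ m / r ^+ m) = c k * r ^+ m * (t ^+ k / t ^+ m / r ^+ k).
    by field; rewrite !expf_neq0.
  have -> : t ^+ k * c m / t ^+ m = c m * r ^+ k * (t ^+ k / t ^+ m / r ^+ k).
    by field; rewrite !expf_neq0.
  by apply: ler_wpM2r => //; rewrite !divr_ge0 ?exprn_ge0 ?ltW.
rewrite -cm mulr0; pose S := \sum_(k < D.+1) c k.
have S0 : 0 <= S by apply: sumr_ge0.
(* The cross inequality moves [a] and [b] one step towards [m]; the product is 0 as soon as one of
   them reaches [m]. *)
have noint a b : (a < m)%N -> (m < b)%N -> c a * c b = 0.
  have [t tE] := ubnP (b - a)%N; elim: t a b tE => // t IH a b tE am mb.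
  apply/eqP; rewrite eq_le mulr_ge0 // andbT.
  apply: le_trans (cross _ _ (ltn_trans am mb)) _.
  have [am'|am'] := eqVneq a.+1 m; first by rewrite am' -cm mul0r.
  have [bm'|bm'] := eqVneq b.-1 m; first by rewrite bm' -cm mulr0.
  by rewrite IH //; lia.
have [lo|hi] : (forall k, (k < m)%N -> c k = 0) \/ (forall k, (m < k)%N -> c k = 0).
  case: (boolP [exists k : 'I_m, c k != 0]) => [/existsP[a ca]|/existsPn ca].
    right=> b mb; have /eqP := noint a b (ltn_ord a) mb.
    by rewrite mulf_eq0 (negPf ca) => /eqP.
  by left=> k km; have := ca (Ordinal km); rewrite negbK => /eqP.
- apply: (le0_of_small S0) => s s0 s1; apply: le_trans (hL s s0) _.
  rewrite /S mulr_suml mulr_sumr; apply: ler_sum => k _.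
  have [km|mk|->] := ltngtP k m; first by rewrite lo // !mul0r mulr0.
    rewrite -(subnK (ltnW mk)) exprD mulrA mulfK ?expf_neq0 ?gt_eqF // mulrC.
    by rewrite ler_wpM2r // expr_le_self // subn_gt0.
  by rewrite -cm !mul0r mulr0.
apply: (le0_of_small S0) => s s0 s1.
have si : 0 < s^-1 by rewrite invr_gt0.
apply: le_trans (hL _ si) _.
rewrite /S mulr_suml mulr_sumr; apply: ler_sum => k _.
have [km|mk|->] := ltngtP k m; last by rewrite -cm !mul0r mulr0.
  rewrite !exprVn invrK -[X in _ / _ * s ^+ X](subnK (ltnW km)) exprD mulrA.
  rewrite mulrAC -(mulrA (c k)) mulVf ?expf_neq0 ?gt_eqF // mulr1 mulrC.
  by rewrite ler_wpM2r // expr_le_self // subn_gt0.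
by rewrite hi // !mul0r mulr0.
Qed.

End GeometricCapacity.

(** * Elimination of the variables *)

Section DegStep.
Variables (R : realType) (n : nat) (p : {mpoly R[n]}) (alpha : 'X_{1..n}) (i : 'I_n).

Lemma mcoeff_partial_restr (m : 'X_{1..n}) : (forall l : 'I_n, (i < l)%N -> m l = 0%N) ->
  (partial_restr alpha i p)@_m = p^`M[upper_part alpha i]@_m.
Proof.
move=> m0; rewrite /partial_restr -/(upper_part alpha i).
set q := p^`M[_]; rewrite comp_mpolyEX raddf_sum /=.
under eq_bigr => k _ do rewrite mcoeffZ comp_mpolyX.
have prodE (k : 'X_{1..n}) : (\prod_(j < n) tnth [tuple (if (i < j)%N then 0 else 'X_j : {mpoly R[n]}) | j < n] j ^+ k j)@_m
    = (k == m)%:R.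
  case: (boolP [exists j : 'I_n, (i < j)%N && (k j != 0%N)]) => [/existsP[j /andP[ij kj]]|/existsPn h].
    rewrite (bigD1 j) //= tnth_mktuple ij expr0n (negPf kj) mul0r mcoeff0.
    by case: eqP => // km; move: kj; rewrite km m0.
  rewrite (eq_bigr (fun j => 'X_j ^+ k j)); first by rewrite -mpolyXE_id mcoeffX.
  move=> j _.
  rewrite tnth_mktuple; case: ifP => // ij; have := h j; rewrite ij negbK /= => /eqP ->.
  by rewrite !expr0.
under eq_bigr do rewrite prodE.
case: (boolP (m \in msupp q)) => [mp|mp].
  rewrite (bigD1_seq m) ?msupp_uniq //= eqxx mulr1 big1 ?addr0 // => k /negPf ->.
  by rewrite mulr0.
rewrite memN_msupp_eq0 // big_seq big1 // => k kp.
by case: eqP => [km|_]; rewrite ?mulr0 //; move: mp; rewrite -km kp.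
Qed.

Lemma in_slice_deg_step d k (m : 'X_{1..n}) : p@_m != 0 -> in_slice d alpha i k m ->
  (k <= deg_step alpha p i)%N.
Proof.
move=> pm /and3P[_ /eqP mi /forallP h].
(* Removing the upper exponents of [m] gives a monomial of the restricted derivative, with the same
   exponent at [i]; its coefficient gains a nonzero falling factorial. *)
pose m' : 'X_{1..n} := [multinom (if (i < l)%N then 0%N else m l) | l < n].
have mE : m = (m' + upper_part alpha i)%MM.
  apply/mnmP => l; rewrite mnmDE !mnmE; case: ifP => il; last by rewrite addn0.
  by have := h l; rewrite il => /eqP.
have m'i : m' i = k by rewrite mnmE ltnn.
have m's : m' \in msupp (partial_restr alpha i p).
  rewrite mcoeff_msupp mcoeff_partial_restr; last by move=> l il; rewrite mnmE il.
  rewrite mcoeff_mderivm [X in p@_X]addmC -mE -mulr_natr mulf_neq0 // pnatr_eq0 -lt0n.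
  by rewrite prodn_gt0 // => l; rewrite ffact_gt0 mnmDE leq_addr.
rewrite /deg_step /deg_in -m'i.
by rewrite (big_rem m') //= leq_maxl.
Qed.

Lemma slice_deg_step d x k : (deg_step alpha p i < k)%N ->
  slice d alpha i (fun m => p@_m) x k = 0.
Proof.
move=> kD; apply: big1 => m sm; case: (eqVneq p@_m 0) => [->|pm]; first by rewrite mul0r.
by have := in_slice_deg_step pm sm; rewrite leqNgt kD.
Qed.

End DegStep.

Section Elimination.
Variables (R : realType) (n d : nat) (p : {mpoly R[n]}) (alpha : 'X_{1..n}).
Hypothesis hp : denormalized_lorentzian d p.
Hypothesis halpha : mdeg alpha = d.

Definition agree j (m : 'X_{1..n}) : bool := [forall l : 'I_n, (j <= l)%N ==> (m l == alpha l)].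
(** The polynomial left after eliminating the variables from [j] on: all of [p] for [j = n], and for
    [j = 1] a single term whose coefficient is that of [alpha] in [p]. *)
Definition partial_value j (x : 'I_n -> R) : R :=
  \sum_(m : 'X_{1..n < d.+1} | (mdeg m == d) && agree j m)
    p@_m * \prod_(l < n | (l < j)%N) x l ^+ m l.
Definition alpha_monomial j (x : 'I_n -> R) : R := \prod_(l < n | (l < j)%N) x l ^+ alpha l.

Lemma partial_value_full x : partial_value n x = p.@[x].
Proof.
have [hom _ _] := hp.
have sz : (msize p <= d.+1)%N.
  have /dhomogP hom' := hom.
  by rewrite msizeE; apply/bigmax_leqP_seq => m mp _; rewrite ltnS -(hom' m mp).
rewrite /partial_value [in RHS](mpolywE sz) raddf_sum /= big_mkcond; apply: eq_bigr => m _.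
rewrite mevalZ mevalX.
have ag : agree n m by apply/forallP => l; rewrite leqNgt ltn_ord.
rewrite ag andbT; case: eqP => [_|md].
  by congr (_ * _); apply: eq_bigl => l; rewrite ltn_ord.
by rewrite (dhomog_nemf_coeff hom) ?mul0r //; apply/eqP.
Qed.

(** The total degree fixes the exponent of the first variable, so agreement on the others
    suffices. *)
Lemma partial_value_alpha j : (j <= 1)%N -> partial_value j (fun=> 1) = p@_alpha.
Proof.
move=> j1; have ad : (mdeg alpha < d.+1)%N by rewrite halpha.
rewrite /partial_value (big_pred1 (BMultinom ad)) /=.
  by rewrite big1 ?mulr1 // => l _; rewrite expr1n.
move=> m; rewrite /= -val_eqE /=; apply/andP/eqP => [[/eqP md /forallP ag]|->]; last first.
  by rewrite halpha eqxx; split=> //; apply/forallP => l; rewrite eqxx implybT.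
have agl (l : 'I_n) : (0 < l)%N -> m l = alpha l.
  by move=> l0; have := ag l; rewrite (leq_trans j1) // => /eqP.
apply/mnmP => l; case: (posnP l) => [l0|/agl //].
have : mdeg m = mdeg alpha by rewrite md halpha.
rewrite !mdegE (bigD1 l) //= [in RHS](bigD1 l) //=.
rewrite (eq_bigr alpha) => [/addIn //|k kl].
apply: agl; rewrite lt0n; apply: contraNneq kl => k0.
by apply/eqP/val_inj; rewrite /= k0 l0.
Qed.

Lemma partial_value_slice (i : 'I_n) x :
  partial_value i x = slice d alpha i (fun m => p@_m) x (alpha i).
Proof.
apply: eq_bigl => m; rewrite /in_slice; congr (_ && _).
apply/forallP/andP => [h|[/eqP mi /forallP h] l].
  split; first by have := h i; rewrite leqnn.
  by apply/forallP => l; apply/implyP => /ltnW il; have := h l; rewrite il.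
apply/implyP; rewrite leq_eqVlt => /orP[/eqP/val_inj <-|il]; first by rewrite mi.
by have := h l; rewrite il.
Qed.

Lemma prod_lt_succ (i : 'I_n) (x : 'I_n -> R) t (m : 'X_{1..n}) :
  \prod_(l < n | (l < i.+1)%N) (if l == i then t else x l) ^+ m l =
  (\prod_(l < n | (l < i)%N) x l ^+ m l) * t ^+ m i.
Proof.
rewrite (bigD1 i) //= eqxx mulrC; congr (_ * _).
rewrite (eq_bigl (fun l : 'I_n => (l < i)%N)); last first.
  by move=> l; rewrite ltnS andbC -val_eqE -ltn_neqAle.
by apply: eq_bigr => l li; rewrite -val_eqE ltn_eqF.
Qed.

Lemma partial_value_expand (i : 'I_n) x t :
  partial_value i.+1 (fun l => if l == i then t else x l) =
  \sum_(k < (deg_step alpha p i).+1) slice d alpha i (fun m => p@_m) x k * t ^+ k.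
Proof.
rewrite /partial_value /slice big_mkcond.
under [RHS]eq_bigr do rewrite mulr_suml big_mkcond.
rewrite [RHS]exchange_big /=; apply: eq_bigr => m _.
rewrite prod_lt_succ mulrA.
have inE k : in_slice d alpha i k m = ((mdeg m == d) && agree i.+1 m) && (m i == k).
  by rewrite /in_slice -andbA; congr (_ && _); rewrite andbC.
under [RHS]eq_bigr do rewrite inE.
case: ifP => ag; last by rewrite big1.
case: (eqVneq p@_m 0) => [->|pm].
  by rewrite !mul0r big1 // => k _; rewrite !mul0r; case: ifP.
have mD : (m i < (deg_step alpha p i).+1)%N.
  by rewrite ltnS; apply: (in_slice_deg_step pm (d := d)); rewrite inE ag eqxx.
rewrite (bigD1 (Ordinal mD)) //= eqxx [X in _ + X]big1 ?addr0 // => k.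
by rewrite -val_eqE eq_sym /= => /negPf ->.
Qed.

Let K (i : 'I_n) : R := geocap R (deg_step alpha p i) (alpha i).

(** With the lower variables frozen, the hypothesis concerns a polynomial in variable [i] alone
    whose coefficients are the slices up to a constant; [geocap_bound] takes the infimum over that
    variable. *)
Lemma capacity_step (i : 'I_n) C L : (0 < i)%N -> 0 <= C ->
  (forall x, (forall l, 0 < x l) -> L <= C * (partial_value i.+1 x / alpha_monomial i.+1 x)) ->
  forall x, (forall l, 0 < x l) -> L <= K i * C * (partial_value i x / alpha_monomial i x).
Proof.
move=> i0 C0 hL x x0; have [_ pnn _] := hp.
pose c k := C / alpha_monomial i x * slice d alpha i (fun m => p@_m) x k.
have am0 : 0 < alpha_monomial i x by apply: prodr_gt0 => l _; rewrite exprn_gt0.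
have Ca : 0 <= C / alpha_monomial i x by rewrite divr_ge0 // ltW.
have := @geocap_bound R c (deg_step alpha p i) (alpha i) L.
have -> : geocap R (deg_step alpha p i) (alpha i) * c (alpha i) =
    K i * C * (partial_value i x / alpha_monomial i x).
  by rewrite /c partial_value_slice; field; rewrite gt_eqF.
apply.
- by move=> k; rewrite mulr_ge0 // slice_ge0.
- by move=> k kD; rewrite /c slice_deg_step ?mulr0.
- move=> a b ab; rewrite /c [leLHS]mulrACA [leRHS]mulrACA (ler_wpM2l (mulr_ge0 Ca Ca)) //.
  have bd : (mdeg (upper_part alpha i) <= d)%N.
    by rewrite -halpha !mdegE; apply: leq_sum => l _; rewrite mnmE; case: ifP.
  exact: (denormalized_slice_cross hp i0 x0 bd ab).
- move=> t t0; pose y l := if l == i then t else x l.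
  have y0 l : 0 < y l by rewrite /y; case: ifP.
  apply: le_trans (hL y y0) _; rewrite partial_value_expand.
  have -> : alpha_monomial i.+1 y = alpha_monomial i x * t ^+ alpha i by exact: prod_lt_succ.
  rewrite le_eqVlt; apply/orP; left; apply/eqP.
  have -> : \sum_(k < (deg_step alpha p i).+1) c k * t ^+ k = C / alpha_monomial i x *
      \sum_(k < (deg_step alpha p i).+1) slice d alpha i (fun m => p@_m) x k * t ^+ k.
    by rewrite mulr_sumr; apply: eq_bigr => k _; rewrite /c -mulrA.
  by field; rewrite !gt_eqF ?exprn_gt0.
Qed.

Lemma capacity_elimination L :
  (forall x, (forall l, 0 < x l) -> L <= partial_value n x / alpha_monomial n x) ->
  L <= (\prod_(l < n | (0 < l)%N) K l) * p@_alpha.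
Proof.
move=> hL.
have K0 l : 0 <= K l by exact: geocap_ge0.
(* Elimination runs down from the last variable and stops at [j = 1], since the first one costs no
   factor; [j = 0] is reached only without variables. *)
have step j : (j <= n)%N -> (0 < j)%N || (n == 0)%N -> forall x, (forall l, 0 < x l) ->
    L <= (\prod_(l < n | (j <= l)%N) K l) * (partial_value j x / alpha_monomial j x).
  move=> jn; rewrite -(subKn jn); elim: (n - j)%N (leq_subr j n) => [|t IH] tn.
    rewrite subn0 => _ x x0; rewrite big_pred0 ?mul1r; first exact: hL.
    by move=> l; rewrite leqNgt ltn_ord.
  move=> j0; have jn' : (n - t.+1 < n)%N by lia.
  have i0 : (0 < Ordinal jn')%N by move: j0 => /=; case: eqP => //; lia.
  move=> x x0.
  have C0 : 0 <= \prod_(l < n | (n - t <= l)%N) K l by apply: prodr_ge0.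
  have -> : \prod_(l < n | (n - t.+1 <= l)%N) K l = K (Ordinal jn') * \prod_(l < n | (n - t <= l)%N) K l.
    rewrite (bigD1 (Ordinal jn')) //=; congr (_ * _); apply: eq_bigl => l.
    by rewrite -val_eqE /=; lia.
  apply: (capacity_step (i := Ordinal jn')) => // y y0.
  have -> : (Ordinal jn').+1 = (n - t)%N by rewrite /=; lia.
  by apply: IH => //; [exact: ltnW | lia].
case: (posnP n) => [n0|n0].
  have no (l : 'I_n) : False by have := ltn_ord l; rewrite [X in (_ < X)%N]n0.
  have n0' : (0 < 0)%N || (n == 0)%N by rewrite n0.
  have := step 0%N (leq0n _) n0' (fun=> 1) (fun=> ltr01).
  rewrite partial_value_alpha // /alpha_monomial.
  by rewrite !big1 ?divr1 // => l; case: (no l).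
have := step 1%N n0 isT (fun=> 1) (fun=> ltr01).
rewrite partial_value_alpha // /alpha_monomial [X in _ / X]big1 ?divr1 // => l _.
by rewrite expr1n.
Qed.

End Elimination.


(** * Bounds on the capacity and the final inequalities *)

Lemma capacity_le (R : realType) n (a : 'X_{1..n}) (q : {mpoly R[n]}) x :
  nonneg_coeffs q -> (forall i, 0 < x i) ->
  capacity (fun i => (a i)%:R) q <= q.@[x] / \prod_(i < n) x i ^+ a i.
Proof.
move=> qnn x0.
have powE (y : 'I_n -> R) : (forall i, 0 < y i) ->
    \prod_(i < n) y i `^ (a i)%:R = \prod_(i < n) y i ^+ a i.
  by move=> y0; apply: eq_bigr => i _; rewrite powR_mulrn ?ltW.
apply: ge_inf; last by exists x => //=; rewrite powE.
exists 0 => _ /= [y y0 <-]; rewrite powE // divr_ge0 //.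
  rewrite mevalE; apply: sumr_ge0 => m _; apply: mulr_ge0; first exact: qnn.
  by apply: prodr_ge0 => i _; rewrite exprn_ge0 ?ltW.
by apply: prodr_ge0 => i _; rewrite exprn_ge0 ?ltW.
Qed.

Lemma capacity_ge0 (R : realType) n (a : 'I_n -> R) (q : {mpoly R[n]}) :
  nonneg_coeffs q -> 0 <= capacity a q.
Proof.
move=> qnn; apply: lb_le_inf.
  by exists (q.@[fun=> 1] / \prod_(i < n) 1 `^ a i), (fun=> 1) => //= _.
move=> _ /= [y y0 <-]; apply: divr_ge0.
  rewrite mevalE; apply: sumr_ge0 => m _; apply: mulr_ge0; first exact: qnn.
  by apply: prodr_ge0 => i _; rewrite exprn_ge0 ?ltW.
by apply: prodr_ge0 => i _; exact: powR_ge0.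
Qed.

Theorem theorem5p10 (R : realType) (n d : nat) (p : {mpoly R[n]})
    (alpha : 'X_{1..n})
    (hp : denormalized_lorentzian d p)
    (halpha : mdeg alpha = d) :
  let di := deg_step alpha p in
  let cap := capacity (fun i => (alpha i)%:R) p in
  let middle :=
    (\prod_(i < n | (0 < i)%N)
       bicapacity ((di i)%:R - (alpha i)%:R) (alpha i)%:R
         (geometric_form R (di i)))^-1 * cap in
  p@_alpha >= middle /\
  middle >=
    (\prod_(i < n | (0 < i)%N)
       Num.max (pow_ratio R (alpha i)%:Z)
               (pow_ratio R ((di i)%:Z - (alpha i)%:Z))) * cap.
Proof.
move=> di cap middle; have [_ pnn _] := hp.
pose K i := geocap R (di i) (alpha i).
have K0 i : 0 <= K i by exact: geocap_ge0.
have capK : cap <= (\prod_(i < n | (0 < i)%N) K i) * p@_alpha.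
  apply: (capacity_elimination hp halpha) => x x0; rewrite (partial_value_full _ hp).
  have -> : alpha_monomial alpha n x = \prod_(i < n) x i ^+ alpha i.
    by apply: eq_bigl => l; rewrite ltn_ord.
  exact: capacity_le.
have cap0 : 0 <= cap by exact: capacity_ge0.
rewrite /middle -[X in X^-1]/(\prod_(i < n | (0 < i)%N) K i).
have PK0 : 0 <= \prod_(i < n | (0 < i)%N) K i by apply: prodr_ge0.
(* A zero product, as when some [di i < alpha i] with [0 < i], forces [cap = 0] by [capK], and both
   lower bounds are then 0. *)
move: PK0; rewrite le_eqVlt => /orP[/eqP PK|PK].
  have -> : cap = 0 by apply/eqP; rewrite eq_le cap0 andbT; move: capK; rewrite -PK mul0r.
  by rewrite !mulr0; split=> //; exact: pnn.
split; first by rewrite mulrC ler_pdivrMr // mulrC.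
apply: ler_wpM2r => //.
have Kpos (i : 'I_n) : (0 < i)%N -> 0 < K i.
  move=> i0; rewrite lt_def K0 andbT; apply: contraTneq PK => Ki.
  by rewrite (bigD1 i) //= Ki mul0r ltxx.
rewrite -prodfV; apply: ler_prod => i i0.
(* A positive factor excludes [di i < alpha i], so the difference inside [pow_ratio] is a natural
   number. *)
have mD : (alpha i <= di i)%N.
  by rewrite leqNgt; apply/negP => /geocap_eq0 Ki; have := Kpos i i0; rewrite /K Ki ltxx.
have [h1 h2] := geocap_pow_ratio R mD.
have pr0 (j : nat) : 0 <= pow_ratio R j%:Z.
  by rewrite /pow_ratio divr_ge0 // exprz_ge0 // ler0z.
rewrite le_max pr0 /= ge_max -div1r !ler_pdivlMr; try exact: Kpos.
by rewrite h1 h2.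
Qed.
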